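(* Let $d\ge2$ and let $I=(i_1,\dots,i_{d-1})$ be any tuple of positive integers, and let $J=\mathbf 1=(1,\dots,1)$. The continuous limit of the generalized pentagram map $T_{I,J}$ in dimension $d$ (and in particular, of any dented pentagram map $T_m$, $1\le m\le d-1$), i.e. the system of evolution equations $du_j(x)/dt=w_j(x)$, $j=0,\dots,d-1$, for $x\in S^1$, is the $(2,d+1)$-KdV flow of the Adler–Gelfand–Dickey hierarchy on the circle.
   Context: For $n$-gons in $\mathbb{RP}^d$, the generalized pentagram map $T_{I,J}$ is $T_{I,J}v_k=P_k\cap P_{k+j_1}\cap\dots\cap P_{k+j_1+\dots+j_{d-1}}$ with $P_k=(v_k,v_{k+i_1},\dots,v_{k+i_1+\dots+i_{d-1}})$ the hyperplane through the $d$ listed vertices; the dented map $T_m$ is the case $J=\mathbf 1$, $I=(1,\dots,1,2,1,\dots,1)$ with $2$ at the $m$th place. Continuous limit. As $n\to\infty$ a polygon becomes a smooth nondegenerate quasi-periodic curve $\gamma(x)$ in $\mathbb{RP}^d$, with lift $G(x)\in\mathbb R^{d+1}$ such that $\det(G,G',\dots,G^{(d)})=1$ and $G(x+2\pi)=MG(x)$, $M\in SL_{d+1}(\mathbb R)$. Then $G^{(d+1)}+u_{d-1}(x)G^{(d-1)}+\dots+u_1(x)G'+u_0(x)G=0$ with $2\pi$-periodic coefficients $u_j$. Let $k_0<k_1<\dots<k_{d-1}$ be the real numbers with $k_l-k_{l-1}=i_l$ for $l=1,\dots,d-1$ and $\sum_lk_l=0$. For small $\epsilon>0$ let $P_\epsilon(x)$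 be the hyperplane through $\gamma(x+k_0\epsilon),\dots,\gamma(x+k_{d-1}\epsilon)$ and let $\ell_\epsilon(x)$ be the envelope curve of the family $P_\epsilon(x)$ (fixed $\epsilon$); i.e. its lift $L_\epsilon(x)\in\mathbb R^{d+1}$, normalized by $\det(L_\epsilon,L_\epsilon',\dots,L_\epsilon^{(d)})=1$ and with $L_\epsilon\to G$ as $\epsilon\to0$, satisfies $\det(G(x+k_0\epsilon),\dots,G(x+k_{d-1}\epsilon),L_\epsilon^{(j)}(x))=0$ for $j=0,\dots,d-1$. One has $L_\epsilon=G+\epsilon^2B+O(\epsilon^3)$ and $L_\epsilon^{(d+1)}+u_{d-1,\epsilon}L_\epsilon^{(d-1)}+\dots+u_{0,\epsilon}L_\epsilon=0$ with $u_{j,0}=u_j$. Writing $u_{j,\epsilon}=u_j+\epsilon^2w_j+O(\epsilon^3)$, the continuous limit is the system $du_j/dt=w_j$, $j=0,\dots,d-1$. KdV flow. For $L=\partial^{d+1}+u_{d-1}(x)\partial^{d-1}+\dots+u_1(x)\partial+u_0(x)$ with periodic coefficients, $\partial=d/dx$, set $Q_2=(L^{2/(d+1)})_+=\partial^2+\frac{2}{d+1}u_{d-1}(x)$ (differential part of the fractional power). The $(2,d+1)$-KdV equation is $dL/dt=[Q_2,L]=Q_2L-LQ_2$. Flows are identified up to a nonzero constant rescaling of time $t$. *)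

(* Defs.v *)
From HB Require Import structures.
From mathcomp Require Export all_boot all_order all_algebra.
From mathcomp Require Export all_classical all_reals all_analysis.
From mathcomp Require Import ring lra zify.
Set Implicit Arguments.
Unset Strict Implicit.
Unset Printing Implicit Defensive.
Import Order.TTheory GRing.Theory Num.Theory.
Import numFieldNormedType.Exports.
Local Open Scope ring_scope.
Local Open Scope classical_set_scope.

(* in ring_scope this notation would denote derivatives of polynomials *)
Local Notation "f ^` ( n )" := (derive1n n f) : ring_scope.

Definition smooth (R : realType) (V : normedModType R) (f : R -> V) : Prop :=
  forall (n : nat) (x : R), derivable (f^`(n)) x 1.

(* Families u : nat -> R -> R of coefficients are only used at indices j < d. *)

(* L f, for L = d^(d+1) + u_(d-1) d^(d-1) + ... + u_0; it acts on vector-valued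
   functions (lifts of curves) as well as on scalar ones. *)
Definition lax (R : realType) (d : nat) (u : nat -> R -> R)
    (V : normedModType R) (f : R -> V) (x : R) : V :=
  f^`(d.+1) x + \sum_(j < d) u j x *: f^`(j) x.

Definition wronskian (R : realType) (d : nat) (G : R -> 'cV[R]_d.+1) (x : R) : R :=
  \det (\matrix_(i < d.+1, j < d.+1) G^`(j) x i 0).

Definition curve_lift (R : realType) (d : nat) (G : R -> 'cV[R]_d.+1) : Prop :=
  [/\ smooth G,
      forall x, wronskian G x = 1 &
      exists2 M : 'M[R]_d.+1, \det M = 1 & forall x, G (x + pi *+ 2) = M *m G x].

(* The coefficients of the differential equation satisfied by G. *)
Definition curve_coefficients (R : realType) (d : nat) (G : R -> 'cV[R]_d.+1)
    (u : nat -> R -> R) : Prop :=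
  (forall j, (j < d)%N -> smooth (u j) /\ forall x, u j (x + pi *+ 2) = u j x) /\
  forall x, lax d u G x = 0.

(* The tuple I is 0-based: its l-th entry is i_(l+1). *)
Definition centered_shifts (R : realType) (d : nat) (I : d.-1.-tuple nat)
    (k : nat -> R) : Prop :=
  (forall l : 'I_d.-1, k l.+1 - k l = (tnth I l)%:R) /\ \sum_(l < d) k l = 0.

(* E is the normalized lift of the envelope of the hyperplanes through
   G (x + k_0 e), ..., G (x + k_(d-1) e), for this value of e. *)
Definition envelope_lift (R : realType) (d : nat) (k : nat -> R)
    (G : R -> 'cV[R]_d.+1) (e : R) (E : R -> 'cV[R]_d.+1) : Prop :=
  [/\ smooth E,
      forall x, wronskian E x = 1 &
      forall (x : R) (j : nat), (j < d)%N ->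
        \det (\matrix_(i < d.+1, l < d.+1)
                if (l < d)%N then G (x + k l * e) i 0 else E^`(j) x i 0) = 0].

(* u_(j,e) = u_j + e^2 w_j + O(e^3) as e tends to 0 from the right, locally
   uniformly in x (hence uniformly on the circle, by periodicity). *)
Definition second_order_expansion (R : realType) (d : nat) (u : nat -> R -> R)
    (ue : R -> nat -> R -> R) (w : nat -> R -> R) : Prop :=
  forall j, (j < d)%N -> forall a b : R, exists C : R,
    \forall e \near 0^'+, forall x, x \in `[a, b] ->
      `|ue e j x - (u j x + e ^+ 2 * w j x)| <= C * e ^+ 3.

(** Formal pseudodifferential operators: [A : nat -> R -> R] together with an
    order N stands for the formal series  sum_n (A n) d^(N-n). *)

Definition gbinom (R : realType) (z : int) (k : nat) : R :=
  (\prod_(m < k) (z%:~R - m%:R)) / (k`!)%:R.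

(* Leibniz rule: d^z o b = sum_k binom(z, k) b^(k) d^(z-k) for z in Z.  Only the
   order N of the left factor enters the formula. *)
Definition psd_mul (R : realType) (N : int) (A B : nat -> R -> R)
    (n : nat) (x : R) : R :=
  \sum_(i < n.+1) \sum_(j < n.+1 | (i + j <= n)%N)
    gbinom R (N - i%:Z) (n - (i + j)) * A i x * (B j)^`(n - (i + j)) x.

(* A is an operator of order 1, hence psd_pow A q one of order q. *)
Fixpoint psd_pow (R : realType) (A : nat -> R -> R) (p : nat) : nat -> R -> R :=
  if p is q.+1 then psd_mul q%:Z (psd_pow A q) A
  else fun n _ => (n == 0%N)%:R.

(* L as a pseudodifferential operator of order d + 1 *)
Definition psd_lax (R : realType) (d : nat) (u : nat -> R -> R)
    (n : nat) (x : R) : R :=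
  if n == 0%N then 1 else
  if (2 <= n <= d.+1)%N then u (d.+1 - n)%N x else 0.

(* S = L^(1/(d+1)) = d + S_1 + S_2 d^(-1) + ... *)
Definition is_lax_root (R : realType) (d : nat) (u : nat -> R -> R)
    (S : nat -> R -> R) : Prop :=
  [/\ forall n, smooth (S n), forall x, S 0%N x = 1 &
      forall n x, psd_pow S d.+1 n x = psd_lax d u n x].

(* (S^2)_+ f, the differential part of S^2 applied to a function *)
Definition square_plus (R : realType) (S : nat -> R -> R) (f : R -> R) (x : R) : R :=
  \sum_(n < 3) psd_pow S 2 n x * f^`(2 - n) x.

(* dL/dt = c [Q_2, L] with Q_2 = (L^(2/(d+1)))_+ and du_j/dt = w_j, as an
   identity between differential operators acting on smooth functions *)
Definition kdv2_flow (R : realType) (d : nat) (c : R) (u w : nat -> R -> R) : Prop :=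
  exists2 S : nat -> R -> R, is_lax_root d u S &
  forall f : R -> R, smooth f -> forall x : R,
    \sum_(j < d) w j x * f^`(j) x =
    c * (square_plus S (lax d u f) x - lax d u (square_plus S f) x).

Lemma derive1nSr (R : realType) (f : R -> R) n : f^`(n.+1) = (derive1 f)^`(n).
Proof. by rewrite /derive1n iterSr. Qed.

Lemma derive1n_cst (R : realType) (c : R) n :
  (fun _ : R => c)^`(n) = fun _ => if n == 0%N then c else 0.
Proof.
elim: n => [|n IH]; first by rewrite derive1n0.
by rewrite derive1nS IH; apply/funext => x; rewrite derive1_cst.
Qed.

Lemma smooth_cst (R : realType) (c : R) : smooth (fun _ : R => c).
Proof. by move=> n x; rewrite derive1n_cst; exact: derivable_cst. Qed.

Fixpoint diffn (R : realType) n (f : R -> R) : Prop :=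
  (forall x, derivable f x 1) /\ if n is m.+1 then diffn m (derive1 f) else True.

Lemma smooth_diffn (R : realType) (f : R -> R) : smooth f <-> forall n, diffn n f.
Proof.
split=> [h n|h n].
  elim: n f h => [|n IH] f h /=; first by split=> // x; exact: (h 0%N).
  split=> [x|]; first exact: (h 0%N).
  by apply: IH => m x; rewrite -derive1nSr; exact: h.
elim: n f h => [|n IH] f h x; first exact: (h 0%N).1.
by rewrite derive1nSr; apply: IH => m; exact: (h m.+1).2.
Qed.

Lemma diffnW (R : realType) n (f : R -> R) : diffn n.+1 f -> diffn n f.
Proof. by elim: n f => [|n IH] f /= [h [h' H]]; split=> //; apply: IH. Qed.

Lemma diffnD (R : realType) n (f g : R -> R) :
  diffn n f -> diffn n g -> diffn n (fun x => f x + g x).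
Proof.
elim: n f g => [|n IH] f g [df hf] [dg hg];
  (split; first by move=> x; exact: (derivableD (df x) (dg x))); first by [].
have -> : derive1 (fun x => f x + g x) = (fun x => derive1 f x + derive1 g x).
  by apply/funext => y; rewrite [LHS]derive1E (deriveD (df y) (dg y)) -!derive1E.
exact: IH.
Qed.

Lemma diffnM (R : realType) n (f g : R -> R) :
  diffn n f -> diffn n g -> diffn n (fun x => f x * g x).
Proof.
elim: n f g => [|n IH] f g hf hg; case: (hf) => df hf'; case: (hg) => dg hg';
  (split; first by move=> x; exact: (derivableM (df x) (dg x))); first by [].
have -> : derive1 (fun x => f x * g x) =
    (fun x => f x * derive1 g x + g x * derive1 f x).
  by apply/funext => y; rewrite [LHS]derive1E (deriveM (df y) (dg y)) -!derive1E.
by apply: diffnD; apply: IH => //; exact: diffnW.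
Qed.

Lemma smoothD (R : realType) (f g : R -> R) :
  smooth f -> smooth g -> smooth (fun x => f x + g x).
Proof. by rewrite !smooth_diffn => hf hg n; exact: diffnD. Qed.

Lemma smoothM (R : realType) (f g : R -> R) :
  smooth f -> smooth g -> smooth (fun x => f x * g x).
Proof. by rewrite !smooth_diffn => hf hg n; exact: diffnM. Qed.

Lemma smooth_derive1n (R : realType) (f : R -> R) n : smooth f -> smooth (f^`(n)).
Proof.
by move=> h m x; have := h (m + n)%N x; rewrite /derive1n iterD.
Qed.

Lemma smooth_sum (R : realType) (T : Type) (r : seq T) (P : pred T)
    (F : T -> R -> R) :
  (forall i, P i -> smooth (F i)) -> smooth (fun x => \sum_(i <- r | P i) F i x).
Proof.
move=> h; elim: r => [|a r IH].
  rewrite (_ : (fun x => _) = (fun=> 0)); first exact: smooth_cst.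
  by apply/funext => x; rewrite big_nil.
have [Pa|Pa] := boolP (P a).
  rewrite (_ : (fun x => _) = (fun x => F a x + \sum_(i <- r | P i) F i x)).
    exact: (@smoothD R (F a) (fun x => \sum_(i <- r | P i) F i x) (h a Pa) IH).
  by apply/funext => x; rewrite big_cons Pa.
rewrite (_ : (fun x => _) = (fun x => \sum_(i <- r | P i) F i x))//.
by apply/funext => x; rewrite big_cons (negbTE Pa).
Qed.

Lemma smooth_psd_mul (R : realType) N (A B : nat -> R -> R) :
  (forall n, smooth (A n)) -> (forall n, smooth (B n)) ->
  forall n, smooth (psd_mul N A B n).
Proof.
move=> hA hB n; rewrite /psd_mul.
apply: smooth_sum => i _; apply: smooth_sum => j _.
apply: smoothM; last exact: smooth_derive1n.
by apply: smoothM => //; exact: smooth_cst.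
Qed.

Lemma smooth_psd_pow (R : realType) (A : nat -> R -> R) p :
  (forall n, smooth (A n)) -> forall n, smooth (psd_pow A p n).
Proof.
move=> hA; elim: p => [|p IH] n /=; first exact: smooth_cst.
exact: smooth_psd_mul.
Qed.

Lemma gbinom0 (R : realType) z : gbinom R z 0 = 1.
Proof. by rewrite /gbinom big_ord0 fact0 divr1. Qed.

Lemma psd_mul0 (R : realType) N (A B : nat -> R -> R) x :
  psd_mul N A B 0 x = A 0%N x * B 0%N x.
Proof.
by rewrite /psd_mul big_ord1 big_mkcond big_ord1 /= ?addn0 subnn gbinom0 mul1r ?derive1n0.
Qed.

Lemma psd_pow0 (R : realType) (A : nat -> R -> R) p :
  A 0%N = (fun=> 1) -> psd_pow A p 0%N = (fun=> 1).
Proof.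
move=> A0; apply/funext => x; elim: p => [|p IH] //=.
by rewrite psd_mul0 IH A0 mul1r.
Qed.

(* coefficient n > 0 of a product of monic operators, modulo lower ones *)
Lemma psd_mul_top (R : realType) N (A B A' B' : nat -> R -> R) n :
  A 0%N = (fun=> 1) -> B 0%N = (fun=> 1) ->
  (forall i, (i <= n)%N -> A i = A' i) -> (forall i, (i <= n)%N -> B i = B' i) ->
  forall x, psd_mul N A B n.+1 x - psd_mul N A' B' n.+1 x =
            (A n.+1 x - A' n.+1 x) + (B n.+1 x - B' n.+1 x).
Proof.
move=> A0 B0 hA hB x.
have A'0 : A' 0%N = (fun=> 1) by rewrite -hA.
have B'0 : B' 0%N = (fun=> 1) by rewrite -hB.
have E (C D : nat -> R -> R) : C 0%N = (fun=> 1) -> D 0%N = (fun=> 1) ->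
  psd_mul N C D n.+1 x =
  (\sum_(j < n.+1) gbinom R N (n.+1 - j) * (D j)^`(n.+1 - j) x
   + D n.+1 x)
   + \sum_(i < n) \sum_(j < n.+1 | (i.+1 + j <= n.+1)%N)
     gbinom R (N - i.+1%:Z) (n.+1 - (i.+1 + j)) * C i.+1 x *
     (D j)^`(n.+1 - (i.+1 + j)) x + C n.+1 x.
  move=> C0 D0; rewrite /psd_mul big_ord_recr big_ord_recl /=; congr (_ + _ + _).
  - under eq_bigl => j do rewrite add0n -ltnS ltn_ord.
    rewrite big_ord_recr /= C0 add0n subnn gbinom0 !mul1r derive1n0; congr (_ + _).
    by apply: eq_bigr => j _; rewrite add0n subr0 mulr1.
  - apply: eq_bigr => i _.
    rewrite big_mkcond big_ord_recr /= /bump /= add1n addSnnS.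
    rewrite ifF ?addr0; last by apply/negbTE; have := ltn_ord i; lia.
    by rewrite [RHS]big_mkcond /=.
  - rewrite big_mkcond big_ord_recl big1 ?addr0 /=; last first.
      by move=> j _; rewrite ifF//; apply/negbTE; rewrite /bump /=; lia.
    by rewrite ?addr0 addn0 leqnn subnn gbinom0 mul1r derive1n0 D0 mulr1.
rewrite E// (E A' B')//.
have -> : \sum_(j < n.+1) gbinom R N (n.+1 - j) * (B j)^`(n.+1 - j) x =
          \sum_(j < n.+1) gbinom R N (n.+1 - j) * (B' j)^`(n.+1 - j) x.
  by apply: eq_bigr => j _; rewrite hB// -ltnS.
have -> : \sum_(i < n) \sum_(j < n.+1 | (i.+1 + j <= n.+1)%N)
     gbinom R (N - i.+1%:Z) (n.+1 - (i.+1 + j)) * A i.+1 x *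
     (B j)^`(n.+1 - (i.+1 + j)) x =
   \sum_(i < n) \sum_(j < n.+1 | (i.+1 + j <= n.+1)%N)
     gbinom R (N - i.+1%:Z) (n.+1 - (i.+1 + j)) * A' i.+1 x *
     (B' j)^`(n.+1 - (i.+1 + j)) x.
  by apply: eq_bigr => i _; apply: eq_bigr => j _; rewrite hA// hB// -ltnS.
ring.
Qed.

Lemma psd_pow_top (R : realType) (A A' : nat -> R -> R) p n :
  A 0%N = (fun=> 1) -> (forall i, (i <= n)%N -> A i = A' i) ->
  (forall i, (i <= n)%N -> psd_pow A p i = psd_pow A' p i) /\
  forall x, psd_pow A p n.+1 x - psd_pow A' p n.+1 x =
            p%:R * (A n.+1 x - A' n.+1 x).
Proof.
move=> A0; elim: p n => [|p IH] n hA.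
  by split=> // x; rewrite subrr mul0r.
have A'0 : A' 0%N = (fun=> 1) by rewrite -hA.
split=> [[|i] ni|x].
- by rewrite !psd_pow0.
- have hA' j : (j <= i)%N -> A j = A' j by move=> ji; apply: hA; lia.
  apply/funext => x; apply/eqP; rewrite -subr_eq0 /= psd_mul_top ?psd_pow0//.
    by rewrite (IH i hA').2 hA// subrr mulr0 addr0.
  exact: (IH i hA').1.
- rewrite /= psd_mul_top ?psd_pow0//; last exact: (IH n hA).1.
  by rewrite (IH n hA).2 -natr1; ring.
Qed.

(* Together with square_plusE, this shows that kdv2_flow does not depend on the
   choice of S, and that Q_2 = d^2 + 2/(d+1) u_(d-1). *)
Lemma lax_root_exists (R : realType) (d : nat) (u : nat -> R -> R) :
  (forall j, (j < d)%N -> smooth (u j)) -> exists S, is_lax_root d u S.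
Proof.
move=> su.
pose l := psd_lax d u.
pose ap := fix ap m : nat -> R -> R := if m is m'.+1 then
   fun n x => if n == m then (l m x - psd_pow (ap m') d.+1 m x) / d.+1%:R
              else ap m' n x
  else fun n x => (n == 0%N)%:R.
have apS m n : ap m.+1 n = if n == m.+1
    then fun x => (l m.+1 x - psd_pow (ap m) d.+1 m.+1 x) / d.+1%:R else ap m n.
  by apply/funext => x /=; case: eqP.
have ap_gt m n : (m < n)%N -> ap m n = (fun=> 0).
  elim: m => [|m IH] mn; first by case: n mn.
  by rewrite apS ifF ?IH//; lia.
have ap_le m n : (n <= m)%N -> ap m n = ap n n.
  elim: m => [|m IH]; first by rewrite leqn0 => /eqP ->.
  rewrite leq_eqVlt => /predU1P[->//|nm].
  by rewrite apS ifF ?IH//; lia.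
have sl n : smooth (l n).
  rewrite /l /psd_lax; case: eqP => [_|_]; first exact: smooth_cst.
  case: (boolP (2 <= n <= d.+1)%N) => h; last exact: smooth_cst.
  by apply: su; lia.
have sap m n : smooth (ap m n).
  elim: m n => [|m IH] n; first exact: smooth_cst.
  rewrite apS; case: ifP => // _.
  have := @smooth_psd_pow R (ap m) d.+1 IH m.+1; move: (psd_pow _ _ _) => P sP.
  have sNP := @smoothM R _ _ (@smooth_cst R (- 1)) sP.
  have := @smoothM R _ _ (@smoothD R _ _ (sl m.+1) sNP) (@smooth_cst R d.+1%:R^-1).
  by congr smooth; apply/funext => x; rewrite mulN1r.
exists (fun n => ap n n); split; [by move=> n; exact: sap | by [] | case=> [|n] x].
  by rewrite psd_pow0.
have H0 i : (i <= n)%N -> ap i i = ap n i by move=> h; rewrite ap_le.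
have := (@psd_pow_top _ (fun n => ap n n) (ap n) d.+1 n erefl H0).2 x.
rewrite apS eqxx (ap_gt n n.+1)// subr0 mulrC divfK ?pnatr_eq0//.
by move/addIr.
Qed.

Lemma square_plusE (R : realType) (d : nat) (u S : nat -> R -> R) (f : R -> R) x :
  (2 <= d)%N -> is_lax_root d u S ->
  square_plus S f x = f^`(2) x + 2 / d.+1%:R * u d.-1 x * f x.
Proof.
move=> d2 [_ S0' hS].
have S0 : S 0%N = (fun=> 1) by apply/funext.
pose A' : nat -> R -> R := fun n _ => (n == 0%N)%:R.
have mulA' N n y : psd_mul N A' A' n.+1 y = 0.
  rewrite /psd_mul big1// => i _; apply: big1 => j _.
  rewrite (derive1n_cst ((j : nat) == 0%N)%:R) /A'.
  have [i0|i0] := eqVneq (i : nat) 0%N; last by rewrite mulr0 mul0r.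
  case: eqP => h; last by rewrite mulr0.
  by rewrite (_ : ((j : nat) == 0%N) = false) ?mulr0//; apply/negbTE; lia.
have powA' p : psd_pow A' p = A'.
  elim: p => [|p IH] //=; rewrite IH; apply/funext => -[|n]; apply/funext => y.
    by rewrite psd_mul0 mulr1.
  exact: mulA'.
have hA0 i : (i <= 0)%N -> S i = A' i by case: i.
have P1 p y : psd_pow S p 1 y = p%:R * S 1%N y.
  by have := (psd_pow_top p S0 hA0).2 y; rewrite powA' /A' !subr0.
have S1 : S 1%N = A' 1%N.
  apply/funext => y; have := hS 1%N y; rewrite P1 /psd_lax /=.
  by move/eqP; rewrite mulf_eq0 pnatr_eq0 /= => /eqP.
have hA1 i : (i <= 1)%N -> S i = A' i by case: i => [|[]].
have P2 p y : psd_pow S p 2 y = p%:R * S 2%N y.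
  by have := (psd_pow_top p S0 hA1).2 y; rewrite powA' /A' !subr0.
have S2 : S 2%N x = u d.-1 x / d.+1%:R.
  have := hS 2%N x; rewrite P2 /psd_lax /= !ltnS.
  rewrite ifT; last by lia.
  rewrite subSS subn1 => <-.
  by rewrite mulrAC divff ?mul1r// pnatr_eq0.
have -> : square_plus S f x = psd_pow S 2 0 x * f^`(2) x +
    psd_pow S 2 1 x * f^`(1) x + psd_pow S 2 2 x * f^`(0) x.
  by rewrite /square_plus !big_ord_recr big_ord0 /= add0r.
rewrite (psd_pow0 2 S0) P1 P2 S1 S2 derive1n0 /A' mulr0 mul0r addr0 mul1r.
by congr (_ + _ * _); rewrite mulrA mulrAC.
Qed.

(* Main.v *)
Require Import Defs.
From mathcomp Require Import perm.
From mathcomp Require Import ring lra zify.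
Set Implicit Arguments.
Unset Strict Implicit.
Unset Printing Implicit Defensive.
Import Order.TTheory GRing.Theory Num.Theory.
Import numFieldNormedType.Exports.
Local Open Scope ring_scope.
Local Open Scope classical_set_scope.

(** Why the theorem holds.  Write d^j for derivatives in x, Q f = f'' +
    2/(d+1) u_(d-1) f, and L for the operator annihilating G.  The factor in Q is
    the one for which [Q, L] has order less than d ([commutator_diffop]), so
    [Q, L] = sum_(j < d) r_j d^j, and the system du_j/dt = c r_j is the KdV flow
    whatever c is.  It remains to find a nonzero c for which w_j = c r_j is the
    e^2-coefficient of u_(j,e).

    The key is that the envelope is, up to a scalar factor, G + c e^2 Q G + O(e^3).
    Let eta_i be the basis dual to G, G', ..., G^(d).  The covector H of the
    hyperplane P_e(x), normalized by H.G^(d) = 1, is eta_d + sum_i e^(d-i) a_i eta_i.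
    By Taylor's formula, the condition H.G(x + k_l e) = 0 says up to O(e^2)
    relative error that sum_(i < d) a_i t^i/i! + t^d/d! vanishes at the k_l, so that
    it is prod_l (t - k_l)/d!.  Since sum_l k_l = 0, the coefficient a_(d-1)
    vanishes to that order, whence H = eta_d + e^2 kappa eta_(d-2) + O(e^3)
    ([small_covec]) with kappa proportional to the second elementary symmetric
    function of the k_l, which is negative ([kappa_lt0]).  With c = - kappa the
    curve X = G + c e^2 Q G satisfies H.X^(j) = O(e^3) for j < d
    ([small_covec_ansatz]), where the envelope E satisfies H.E^(j) = 0.  By moving
    derivatives from one factor to the other, these become statements on
    H^(i).X^(j) and H^(i).E with i + j < d, and the d equations H^(i).E = 0
    determine E up to a factor; so E = b (X + O(e^3)) for a scalar function b
    ([y_env]).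

    To conclude, (L + e^2 W) X = O(e^4) when W = c [Q, L], because L G = 0.
    Thus X satisfies, up to O(e^3), an equation without a term of order d.  So does
    E = b (X + O(e^3)), and comparing the coefficients of X^(d) gives b'/b = O(e^3)
    ([derive1_multiplier]).  Therefore (L + e^2 W) E = b O(e^3), and solving for
    the coefficients of the equation of E, a linear system whose matrix is close to
    the Wronskian matrix of G, shows u_(j,e) = u_j + e^2 w_j + O(e^3) ([small_ue]).

    All O(e^m) must survive differentiation in x.  They are therefore taken in an
    algebra of families of functions, called tame below, that is stable under d. *)

(* in ring_scope these notations would denote derivatives of polynomials *)
Local Notation "f ^` ( n )" := (derive1n n f) : ring_scope.
Local Notation "f ^` ()" := (derive1 f) : ring_scope.

(** * Derivatives and Taylor remainders on bounded intervals *)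

Section Pointwise.
Variable R : realType.
Implicit Types (f g : R -> R) (x a : R).

Lemma derive1D f g x : derivable f x 1 -> derivable g x 1 ->
  (fun y => f y + g y)^`() x = f^`() x + g^`() x.
Proof. by move=> df dg; rewrite derive1E (deriveD df dg) -!derive1E. Qed.

Lemma derive1M f g x : derivable f x 1 -> derivable g x 1 ->
  (fun y => f y * g y)^`() x = f^`() x * g x + f x * g^`() x.
Proof.
move=> df dg; rewrite derive1E (deriveM df dg) -!derive1E /GRing.scale /=.
by rewrite addrC; congr (_ + _); rewrite mulrC.
Qed.

Lemma derive1Z a f x : derivable f x 1 ->
  (fun y => a * f y)^`() x = a * f^`() x.
Proof. by move=> df; rewrite derive1E (deriveZ a df) -derive1E. Qed.

Lemma derivableZc a f x : derivable f x 1 -> derivable (fun y => a * f y) x 1.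
Proof. by move=> df; exact: (derivableM (derivable_cst a x 1) df). Qed.

Lemma derive1_inv f x : f x != 0 -> derivable f x 1 ->
  (fun y => (f y)^-1)^`() x = - 1 * (f^`() x * ((f x)^-1 * (f x)^-1)).
Proof.
move=> fx df; rewrite derive1E (deriveV fx df) -derive1E /GRing.scale /=.
by rewrite expr2 invfM mulNr mulNr mul1r mulrC.
Qed.

Lemma derivable_sumf (T : Type) (r : seq T) (F : T -> R -> R) x :
  (forall i, derivable (F i) x 1) -> derivable (fun y => \sum_(i <- r) F i y) x 1.
Proof.
move=> h; elim: r => [|i r IH].
  by under eq_fun do rewrite big_nil; exact: derivable_cst.
under eq_fun do rewrite big_cons.
exact: (derivableD (h i) IH).
Qed.

Lemma derive1_sumf (T : Type) (r : seq T) (F : T -> R -> R) x :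
  (forall i, derivable (F i) x 1) ->
  (fun y => \sum_(i <- r) F i y)^`() x = \sum_(i <- r) (F i)^`() x.
Proof.
move=> h; elim: r => [|i r IH].
  by under eq_fun do rewrite big_nil; rewrite big_nil derive1_cst.
under eq_fun do rewrite big_cons.
rewrite big_cons derive1D ?IH//; exact: derivable_sumf.
Qed.

Let shift_quotient f a x :
  (fun h : R => h^-1 *: (((fun y => f (y + a)) \o shift x) (h *: 1) - f (x + a))) =
  (fun h : R => h^-1 *: ((f \o shift (x + a)) (h *: 1) - f (x + a))).
Proof. by apply/funext => h /=; rewrite addrA. Qed.

Lemma derive1_shift f a x : (fun y => f (y + a))^`() x = f^`() (x + a).
Proof.
rewrite !derive1E.
exact: (congr1 (fun F : R -> R => lim (F @ 0^')) (shift_quotient f a x)).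
Qed.

Lemma derivable_shift f a x : derivable f (x + a) 1 ->
  derivable (fun y => f (y + a)) x 1.
Proof. by rewrite /derivable -shift_quotient. Qed.

Lemma near_ball0 (r x : R) : `|x| < r -> \forall y \near x, `|y| < r.
Proof.
move=> xr; near=> y.
have : `|x - y| < r - `|x|.
  by near: y; apply: cvgr_dist_lt; [exact: cvg_id | rewrite subr_gt0].
have := ler_normD (y - x) x; rewrite subrK (distrC x y); lra.
Unshelve. all: by end_near. Qed.

Lemma derive1_ext r f g x : (forall y, `|y| < r -> f y = g y) -> `|x| < r ->
  f^`() x = g^`() x.
Proof.
move=> fg xr; rewrite !derive1E; apply: near_eq_derive.
by apply: filterS (near_ball0 xr) => y; exact: fg.
Qed.

Lemma derivable_ext r f g x : (forall y, `|y| < r -> f y = g y) -> `|x| < r ->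
  derivable f x 1 -> derivable g x 1.
Proof.
move=> fg xr; apply: near_eq_derivable.
by apply: filterS (near_ball0 xr) => y; exact: fg.
Qed.

Lemma smooth_bounded f (r : R) : (forall x, derivable f x 1) ->
  exists C, forall x, `|x| < r -> `|f x| <= C.
Proof.
move=> df; have [r0|r0] := ltP r 0.
  by exists 0 => x xr; have := normr_ge0 x; lra.
have cf : {within `[- r, r], continuous f}.
  by apply: derivable_within_continuous => x _; exact: df.
have rr : - r <= r by lra.
have [p _ hp] := EVT_max rr cf; have [q _ hq] := EVT_min rr cf.
exists (`|f p| + `|f q|) => x; rewrite ltr_norml => /andP[x1 x2].
have xr : x \in `[- r, r]%R by rewrite in_itv /= !ltW.
have := hp x xr; have := hq x xr.
have := ler_norm (f p); have := ler_norm (- f q); rewrite normrN.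
have := normr_ge0 (f p); have := normr_ge0 (f q).
by rewrite ler_norml => *; apply/andP; split; lra.
Qed.

(** A bound on the C^N norm over the open interval (-r, r).  The recursion, rather
    than a quantifier over the order of the derivative, lets products and inverses
    be treated by induction on N. *)
Fixpoint ck_bound N (r C : R) f : Prop :=
  (forall x, `|x| < r -> `|f x| <= C) /\
  if N is M.+1 then
    (forall x, `|x| < r -> derivable f x 1) /\ ck_bound M r C f^`()
  else True.

Lemma ck_bound_norm N r C f : ck_bound N r C f -> forall x, `|x| < r -> `|f x| <= C.
Proof. by case: N => [|N] []. Qed.

Lemma ck_bound_ext N r C f g : (forall x, `|x| < r -> f x = g x) ->
  ck_bound N r C f -> ck_bound N r C g.
Proof.
elim: N f g => [|N IH] f g fg [bf H]; split => //.
- by move=> x xr; rewrite -fg// bf.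
- by move=> x xr; rewrite -fg// bf.
case: H => df Hf; split; first by move=> x xr; exact: derivable_ext fg xr (df x xr).
by apply: IH Hf => x xr; exact: derive1_ext fg xr.
Qed.

Lemma ck_bound_le N r C D f : C <= D -> ck_bound N r C f -> ck_bound N r D f.
Proof.
move=> CD; elim: N f => [|N IH] f [bf H]; split=> //.
- by move=> x xr; exact: le_trans (bf x xr) CD.
- by move=> x xr; exact: le_trans (bf x xr) CD.
- by case: H => df Hf; split=> //; exact: IH.
Qed.

Lemma ck_boundW N r C f : ck_bound N.+1 r C f -> ck_bound N r C f.
Proof.
elim: N f => [|N IH] f; first by case.
by move=> [bf [df Hf]]; split=> //; split=> //; exact: IH.
Qed.

Lemma ck_boundD N r C D f g : ck_bound N r C f -> ck_bound N r D g ->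
  ck_bound N r (C + D) (fun x => f x + g x).
Proof.
elim: N f g => [|N IH] f g [bf H] [bg K].
  by split=> // x xr; rewrite (le_trans (ler_normD _ _))// lerD ?bf ?bg.
split; first by move=> x xr; rewrite (le_trans (ler_normD _ _))// lerD ?bf ?bg.
case: H => df Hf; case: K => dg Kg; split.
  by move=> x xr; exact: (derivableD (df x xr) (dg x xr)).
apply: ck_bound_ext (IH _ _ Hf Kg) => x xr.
by rewrite derive1D//; [exact: df|exact: dg].
Qed.

Lemma ck_boundM N r C D f g : ck_bound N r C f -> ck_bound N r D g ->
  ck_bound N r (2 ^+ N * (C * D)) (fun x => f x * g x).
Proof.
have B f' g' : (forall x, `|x| < r -> `|f' x| <= C) ->
    (forall x, `|x| < r -> `|g' x| <= D) ->
    forall M x, `|x| < r -> `|f' x * g' x| <= 2 ^+ M * (C * D).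
  move=> bf bg M x xr; rewrite normrM.
  have CD : `|f' x| * `|g' x| <= C * D by rewrite ler_pM ?bf ?bg.
  rewrite (le_trans CD)// ler_peMl//; last by apply: exprn_ege1; lra.
  exact: le_trans CD; rewrite mulr_ge0.
elim: N f g => [|N IH] f g Hf Hg.
  by split=> //; apply: B; [exact: ck_bound_norm Hf|exact: ck_bound_norm Hg].
split; first by apply: B; [exact: ck_bound_norm Hf|exact: ck_bound_norm Hg].
case: (Hf) => bf [df Hf']; case: (Hg) => bg [dg Hg']; split.
  by move=> x xr; exact: (derivableM (df x xr) (dg x xr)).
have -> : 2 ^+ N.+1 * (C * D) = 2 ^+ N * (C * D) + 2 ^+ N * (C * D).
  by rewrite exprS; ring.
apply: ck_bound_ext (ck_boundD (IH _ _ Hf' (ck_boundW Hg)) (IH _ _ (ck_boundW Hf) Hg')) => x xr.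
by rewrite derive1M//; [exact: df|exact: dg].
Qed.

Lemma ck_bound_cst N r (a : R) : ck_bound N r `|a| (fun=> a).
Proof.
elim: N a => [|N IH] a; split=> //; split; first by move=> x _; exact: derivable_cst.
apply: (@ck_bound_le _ _ `|0 : R|); first by rewrite normr0.
by apply: ck_bound_ext (IH 0) => x _; rewrite derive1_cst.
Qed.

Lemma ck_bound_derive1 N r C f : ck_bound N.+1 r C f -> ck_bound N r C f^`().
Proof. by case=> _ []. Qed.

Lemma ck_bound_derivable N r C f : ck_bound N.+1 r C f ->
  forall x, `|x| < r -> derivable f x 1.
Proof. by case=> _ []. Qed.

(** The bound for 1/f must depend on f only through its own bounds, so that it is
    uniform over a family of functions. *)
Lemma ck_boundV N (C D : R) : exists C', forall r f, ck_bound N r C f ->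
  (forall x, `|x| < r -> f x != 0 /\ `|(f x)^-1| <= D) ->
  ck_bound N r C' (fun x => (f x)^-1).
Proof.
elim: N => [|N [C' IH]].
  by exists D => r f _ H; split=> // x xr; exact: (H x xr).2.
pose C1 := 2 ^+ N * (`|- 1| * (2 ^+ N * (C * (2 ^+ N * (C' * C'))))).
exists (Num.max D C1) => r f Hf H; split.
  by move=> x xr; rewrite le_max (H x xr).2.
case: (Hf) => bf [df Hf']; split.
  by move=> x xr; apply: derivableV; [exact: (H x xr).1|exact: df].
apply: (@ck_bound_le _ _ C1); first by rewrite le_max lexx orbT.
have HV := IH _ _ (ck_boundW Hf) H.
apply: ck_bound_ext (ck_boundM (ck_bound_cst N r (- 1)) (ck_boundM Hf' (ck_boundM HV HV))) => x xr.
by rewrite derive1_inv//; [exact: (H x xr).1|exact: df].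
Qed.

Lemma smooth_derive1 f : smooth f -> smooth f^`().
Proof. by move=> sf; rewrite -derive1n1; exact: smooth_derive1n. Qed.

Lemma smooth_derivable f : smooth f -> forall x, derivable f x 1.
Proof. by move=> sf; exact: (sf 0%N). Qed.

Lemma smooth_ck_bound N r f : smooth f -> exists C, ck_bound N r C f.
Proof.
elim: N f => [|N IH] f sf.
  by have [C hC] := smooth_bounded r (smooth_derivable sf); exists C.
have [C hC] := smooth_bounded r (smooth_derivable sf).
have [D hD] := IH _ (smooth_derive1 sf).
exists (Num.max C D); split.
  by move=> x xr; rewrite le_max hC.
split; first by move=> x _; exact: smooth_derivable.
by apply: ck_bound_le hD; rewrite le_max lexx orbT.
Qed.

Definition taylor_rem N f (s x : R) : R :=
  f (x + s) - \sum_(i < N) s ^+ i / (i`!)%:R * f^`(i) x.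

(** In the variable s, the derivative of the remainder of f is the remainder of f'
    of one order less; the mean value theorem gives the bound by induction. *)
Lemma taylor_rem_bound N f (s x C : R) : smooth f ->
  (forall t, `|t| <= `|s| -> `|f^`(N) (x + t)| <= C) ->
  `|taylor_rem N f s x| <= C * `|s| ^+ N.
Proof.
elim: N f s => [|N IH] f s sf bf.
  by rewrite /taylor_rem big_ord0 subr0 expr0 mulr1; apply: bf.
pose phi t := taylor_rem N.+1 f t x.
have phiE t : phi t = f (x + t) - f x -
    \sum_(i < N) t ^+ i.+1 / (i.+1`!)%:R * f^`(i.+1) x.
  rewrite /phi /taylor_rem big_ord_recl /= expr0 fact0 divr1 mul1r ?derive1n0.
  by rewrite opprD addrA.
have dphi (t : R) : is_derive t 1 phi (taylor_rem N f^`() t x).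
  have h1 : is_derive t 1 (fun t => f (x + t)) (f^`() (x + t)).
    apply: DeriveDef.
      by under eq_fun do rewrite addrC; apply: derivable_shift; exact: smooth_derivable.
    rewrite -derive1E; under eq_fun do rewrite addrC.
    by rewrite derive1_shift addrC.
  have h2 : is_derive t 1 (fun t => \sum_(i < N) t ^+ i.+1 / (i.+1`!)%:R * f^`(i.+1) x)
     (\sum_(i < N) t ^+ i / (i`!)%:R * (f^`())^`(i) x).
    have hi (i : 'I_N) : is_derive t 1 (fun t => t ^+ i.+1 / (i.+1`!)%:R * f^`(i.+1) x)
       (t ^+ i / (i`!)%:R * (f^`())^`(i) x).
      have -> : (fun t => t ^+ i.+1 / (i.+1`!)%:R * f^`(i.+1) x) =
          (fun t : R => ((f^`())^`(i) x / (i.+1`!)%:R) * (t ^+ i.+1)).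
        by apply/funext => y; rewrite derive1nSr; ring.
      have dX : derivable (fun t : R => t ^+ i.+1) t 1.
        exact: exprn_derivable.
      apply: DeriveDef; first exact: derivableZc.
      rewrite -derive1E derive1Z// exp_derive1 /GRing.scale /=.
      have f0 : (i`!)%:R != 0 :> R by rewrite pnatr_eq0 -lt0n fact_gt0.
      rewrite factS natrM.
      by field; rewrite f0 addrC natr1 pnatr_eq0.
    apply: DeriveDef.
      by apply: (@derivable_sumf _ _ (fun (i : 'I_N) t => t ^+ i.+1 / (i.+1`!)%:R * f^`(i.+1) x)) => i; case: (hi i).
    rewrite -derive1E (@derive1_sumf _ _ (fun (i : 'I_N) t => t ^+ i.+1 / (i.+1`!)%:R * f^`(i.+1) x)); last by move=> i; case: (hi i).
    by apply: eq_bigr => i _; rewrite derive1E; case: (hi i).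
  have -> : phi = (fun t => f (x + t) - f x -
      \sum_(i < N) t ^+ i.+1 / (i.+1`!)%:R * f^`(i.+1) x) by apply/funext.
  apply: is_derive_eq.
  by rewrite subr0.
have phi0 : phi 0 = 0.
  rewrite phiE addr0 subrr big1 ?subr0// => i _.
  by rewrite expr0n /= !mul0r.
have cphi : continuous phi.
  by move=> t; apply/differentiable_continuous/derivable1_diffP; case: (dphi t).
have key t : `|t| <= `|s| -> `|taylor_rem N f^`() t x| <= C * `|s| ^+ N.
  move=> ts; apply: le_trans (IH _ t (smooth_derive1 sf) _) _.
    by move=> q qt; rewrite -derive1nSr; apply: bf; exact: le_trans qt ts.
  apply: ler_wpM2l; last by apply: lerXn2r; rewrite ?nnegrE.
  by apply: le_trans (bf 0 _); rewrite ?normr0.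
rewrite -/(phi s).
have [s0|s0] := leP 0 s.
  have [c cs] := MVT_segment s0 (fun t _ => dphi t) (continuous_subspaceT cphi).
  rewrite phi0 !subr0 => ->; rewrite normrM exprSr mulrA ler_wpM2r//.
  apply: key; move: cs; rewrite in_itv /= => /andP[c0 cs].
  by rewrite !ger0_norm// (le_trans c0).
have [c cs] := MVT_segment (ltW s0) (fun t _ => dphi t) (continuous_subspaceT cphi).
rewrite phi0 !sub0r => /eqP; rewrite eqr_oppLR => /eqP ->.
rewrite normrN normrM normrN exprSr mulrA ler_wpM2r//.
apply: key; move: cs; rewrite in_itv /= => /andP[c0 cs].
by rewrite (ler0_norm cs) (ltr0_norm s0) lerN2.
Qed.

Lemma derivable_taylor_rem N f s x : smooth f -> derivable (taylor_rem N f s) x 1.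
Proof.
move=> sf; apply: derivableB.
  by apply: derivable_shift; exact: smooth_derivable.
apply: (@derivable_sumf _ _ (fun (i : 'I_N) x => s ^+ i / (i`!)%:R * f^`(i) x)) => i.
by apply: derivableZc; exact: sf.
Qed.

Lemma derive1_taylor_rem N f s : smooth f ->
  (taylor_rem N f s)^`() = taylor_rem N f^`() s.
Proof.
move=> sf; apply/funext => x.
have d1 : derivable (fun x => f (x + s)) x 1.
  by apply: derivable_shift; exact: smooth_derivable.
have di (i : 'I_N) : derivable (fun x => s ^+ i / (i`!)%:R * f^`(i) x) x 1.
  by apply: derivableZc; exact: sf.
have d2 := @derivable_sumf _ (index_enum 'I_N) (fun (i : 'I_N) x => s ^+ i / (i`!)%:R * f^`(i) x) x di.
rewrite derive1E (deriveB d1 d2) -!derive1E derive1_shift; congr (_ - _).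
rewrite (derive1_sumf _ di); apply: eq_bigr => i _.
by rewrite (derive1Z _ (sf i x)) -derive1nS derive1nSr.
Qed.

(** In the variable x, the derivative of the remainder of f is the remainder of f'
    of the same order, so the pointwise bound controls all derivatives in x. *)
Lemma ck_bound_taylor_rem M N f (r s0 : R) : smooth f -> exists C, forall s,
  `|s| <= s0 -> ck_bound M r (C * `|s| ^+ N) (taylor_rem N f s).
Proof.
elim: M f => [|M IH] f sf.
  have [C hC] := smooth_bounded (r + s0) (sf N).
  exists C => s ss0; split=> // x xr; apply: taylor_rem_bound => // t ts.
  by apply: hC; have := ler_normD x t; lra.
have [C hC] := smooth_bounded (r + s0) (sf N).
have [D hD] := IH _ (smooth_derive1 sf).
exists (Num.max C D) => s ss0; split.
  move=> x xr; apply: (@le_trans _ _ (C * `|s| ^+ N)).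
    by apply: taylor_rem_bound => // t ts; apply: hC; have := ler_normD x t; lra.
  by rewrite ler_wpM2r ?exprn_ge0// le_max lexx.
split; first by move=> x _; exact: derivable_taylor_rem.
rewrite derive1_taylor_rem//; apply: ck_bound_le (hD s ss0).
by rewrite ler_wpM2r ?exprn_ge0// le_max lexx orbT.
Qed.

End Pointwise.

(** * Families of functions depending on a small parameter *)

Section Families.
Variable R : realType.
Implicit Types (F G H : R -> R -> R) (P Q : R -> R -> Prop).

(** The range of e may shrink as r grows: local uniformity in x is all that is
    available, and it lets one invert functions that are only locally close to a
    nonzero constant. *)
Definition near0 P : Prop :=
  forall r : R, \forall e \near 0^'+, forall x : R, `|x| < r -> P e x.

Lemma near0W P Q : (forall e x, P e x -> Q e x) -> near0 P -> near0 Q.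
Proof. by move=> PQ hP r; apply: filterS (hP r) => e h x xr; exact/PQ/h. Qed.

Lemma near0_2 P Q S : (forall e x, P e x -> Q e x -> S e x) ->
  near0 P -> near0 Q -> near0 S.
Proof.
move=> PQ hP hQ r; apply: filterS2 (hP r) (hQ r) => e h1 h2 x xr.
by apply: PQ; [exact: h1|exact: h2].
Qed.

Lemma near0_3 P Q S T : (forall e x, P e x -> Q e x -> S e x -> T e x) ->
  near0 P -> near0 Q -> near0 S -> near0 T.
Proof.
move=> h hP hQ hS r; apply: filterS3 (hP r) (hQ r) (hS r) => e h1 h2 h3 x xr.
by apply: h; [exact: h1|exact: h2|exact: h3].
Qed.

Lemma near0_forall (I : finType) (P : I -> R -> R -> Prop) :
  (forall i, near0 (P i)) -> near0 (fun e x => forall i, P i e x).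
Proof.
move=> h r.
have H : \forall e \near 0^'+, forall i x, `|x| < r -> P i e x.
  by apply: filter_forall => i; exact: h.
by apply: filterS H => e he x xr i; exact: he.
Qed.

Lemma near0_param (P : R -> Prop) : (\forall e \near 0^'+, P e) -> near0 (fun e _ => P e).
Proof. by move=> h r; apply: filterS h => e Pe x _. Qed.

Lemma near0_gt0 : near0 (fun e _ => 0 < e).
Proof. by apply: near0_param; exact: nbhs_right_gt. Qed.

Lemma near0_all P : (forall e x, P e x) -> near0 P.
Proof. by move=> h r; apply: filterE => e x _. Qed.

Lemma near0_derive1 F G : near0 (fun e x => F e x = G e x) ->
  near0 (fun e x => (F e)^`() x = (G e)^`() x).
Proof.
by move=> h r; apply: filterS (h r) => e he x; exact: derive1_ext.
Qed.

(** Tame families form an algebra stable under differentiation in x, up to equality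
    for small e; they play the role of O(1). *)
Definition tame F : Prop :=
  forall N r, exists C, \forall e \near 0^'+, ck_bound N r C (F e).

Lemma tame_ext F G : near0 (fun e x => F e x = G e x) -> tame F -> tame G.
Proof.
move=> FG tF N r; have [C hC] := tF N r; exists C.
by apply: filterS2 hC (FG r) => e h1 h2; exact: ck_bound_ext h1.
Qed.

Lemma tame_smooth (f : R -> R) : smooth f -> tame (fun _ => f).
Proof.
move=> sf N r; have [C hC] := smooth_ck_bound N r sf; exists C.
exact: filterE.
Qed.

Lemma tame_cst (a : R) : tame (fun _ _ => a).
Proof. by apply: tame_smooth; exact: smooth_cst. Qed.

Lemma tameD F G : tame F -> tame G -> tame (fun e x => F e x + G e x).
Proof.
move=> tF tG N r; have [C hC] := tF N r; have [D hD] := tG N r; exists (C + D).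
by apply: filterS2 hC hD => e h1 h2; exact: ck_boundD.
Qed.

Lemma tameM F G : tame F -> tame G -> tame (fun e x => F e x * G e x).
Proof.
move=> tF tG N r; have [C hC] := tF N r; have [D hD] := tG N r.
exists (2 ^+ N * (C * D)); apply: filterS2 hC hD => e h1 h2; exact: ck_boundM.
Qed.

Lemma tame_param : tame (fun e _ => e).
Proof.
move=> N r; exists 1; apply: filterS2 (nbhs_right_gt 0) (nbhs_right_lt ltr01).
move=> e e0 e1; apply: ck_bound_le (ck_bound_cst N r e).
by rewrite ger0_norm ltW.
Qed.

Lemma tame_derive1 F : tame F -> tame (fun e => (F e)^`()).
Proof.
move=> tF N r; have [C hC] := tF N.+1 r; exists C.
by apply: filterS hC => e; exact: ck_bound_derive1.
Qed.

Lemma tame_derive1n j F : tame F -> tame (fun e => (F e)^`(j)).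
Proof.
elim: j F => [|j IH] F tF //.
have := IH _ (tame_derive1 tF); apply: tame_ext; apply: near0_all => e x.
by rewrite derive1nSr.
Qed.

Lemma tame_derivable F : tame F -> near0 (fun e x => derivable (F e) x 1).
Proof.
move=> tF r; have [C hC] := tF 1%N r.
by apply: filterS hC => e; exact: ck_bound_derivable.
Qed.

Lemma tame_bounded F r : tame F ->
  exists C, \forall e \near 0^'+, forall x, `|x| < r -> `|F e x| <= C.
Proof.
move=> tF; have [C hC] := tF 0%N r; exists C.
by apply: filterS hC => e; exact: ck_bound_norm.
Qed.

Lemma tame_taylor_rem N (f : R -> R) (k : R) : smooth f ->
  tame (fun e x => e ^- N * taylor_rem N f (k * e) x).
Proof.
move=> sf M r; have [C hC] := ck_bound_taylor_rem M N r `|k| sf.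
exists (2 ^+ M * (1 * (C * `|k| ^+ N))).
apply: filterS2 (nbhs_right_gt 0) (nbhs_right_lt ltr01) => e e0 e1.
have ke : `|k * e| <= `|k|.
  by rewrite normrM ler_piMr// ger0_norm ltW.
have := ck_boundM (ck_bound_cst M r (e ^- N)) (hC _ ke).
congr (ck_bound _ _ (_ * _) _).
have eN : 0 < e ^+ N by rewrite exprn_gt0.
rewrite normrM exprMn (ger0_norm (ltW e0)) [`|_ ^- N|]ger0_norm ?invr_ge0 1?ltW//.
by field; rewrite gt_eqF.
Qed.

(** The role of O(e^m): the m-th power of the ideal generated by e, which is
    stable under differentiation in x. *)
Definition small (m : nat) F : Prop := tame (fun e x => e ^- m * F e x).

Lemma small0 F : small 0 F <-> tame F.
Proof. by split; apply: tame_ext; apply: near0_all => e x; rewrite expr0 invr1 mul1r. Qed.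

Lemma small_ext m F G : near0 (fun e x => F e x = G e x) -> small m F -> small m G.
Proof. by move=> FG; apply: tame_ext; apply: near0W FG => e x ->. Qed.

Lemma small_eq m F G : (forall e x, F e x = G e x) -> small m F -> small m G.
Proof. by move=> FG; apply: small_ext; exact: near0_all. Qed.

Lemma smallD m F G : small m F -> small m G -> small m (fun e x => F e x + G e x).
Proof.
move=> tF tG; apply: tame_ext (tameD tF tG).
by apply: near0_all => e x; rewrite mulrDr.
Qed.

Lemma smallM m n F G : small m F -> small n G ->
  small (m + n) (fun e x => F e x * G e x).
Proof.
move=> tF tG; apply: tame_ext (tameM tF tG).
by apply: near0_all => e x; rewrite exprD invfM; ring.
Qed.

Lemma smallMl m F G : tame F -> small m G -> small m (fun e x => F e x * G e x).
Proof. by move=> /small0 tF sG; exact: (smallM tF sG). Qed.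

Lemma smallMr m F G : small m F -> tame G -> small m (fun e x => F e x * G e x).
Proof. by move=> sF /small0 tG; have := smallM sF tG; rewrite addn0. Qed.

Lemma smallN m F : small m F -> small m (fun e x => - F e x).
Proof.
move=> sF; apply: small_eq (smallMl (tame_cst (-1)) sF) => e x.
by rewrite mulN1r.
Qed.

Lemma smallB m F G : small m F -> small m G -> small m (fun e x => F e x - G e x).
Proof. by move=> sF sG; exact: smallD (smallN sG). Qed.

Lemma small_pow m : small m (fun e _ => e ^+ m).
Proof.
apply: tame_ext (tame_cst 1); apply: near0W near0_gt0 => e _ e0.
by rewrite mulVf// expf_neq0// gt_eqF.
Qed.

Lemma small_zero m : small m (fun _ _ => 0).
Proof. by apply: tame_ext (tame_cst 0); apply: near0_all => e x; rewrite mulr0. Qed.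

Lemma tame_pow m : tame (fun e _ => e ^+ m).
Proof.
elim: m => [|m IH]; first exact: tame_cst.
apply: tame_ext (tameM tame_param IH); apply: near0_all => e x.
by rewrite exprS.
Qed.

Lemma smallW m n F : (m <= n)%N -> small n F -> small m F.
Proof.
move=> mn sF; apply: tame_ext (tameM (tame_pow (n - m)) sF).
apply: near0W near0_gt0 => e x e0.
rewrite mulrA; congr (_ * _); rewrite -{2}(subnK mn) exprD.
by field; rewrite !expf_neq0// gt_eqF.
Qed.

Lemma small_tame m F : small m F -> tame F.
Proof. by move=> sF; apply/small0; exact: smallW sF. Qed.

Lemma small_powM m n F : small m F -> small (n + m) (fun e x => e ^+ n * F e x).
Proof. by move=> sF; exact: smallM (small_pow n) sF. Qed.

Lemma small_derive1 m F : small m F -> small m (fun e => (F e)^`()).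
Proof.
move=> sF; apply: tame_ext (tame_derive1 sF).
have tF := tame_derivable (small_tame sF).
by apply: near0W tF => e x; exact: derive1Z.
Qed.

Lemma small_sum m (T : Type) (r : seq T) (F : T -> R -> R -> R) :
  (forall i, small m (F i)) -> small m (fun e x => \sum_(i <- r) F i e x).
Proof.
move=> h; elim: r => [|i r IH].
  by apply: small_eq (small_zero m) => e x; rewrite big_nil.
by apply: small_eq (smallD (h i) IH) => e x; rewrite big_cons.
Qed.

Lemma tame_sum (T : Type) (r : seq T) (F : T -> R -> R -> R) :
  (forall i, tame (F i)) -> tame (fun e x => \sum_(i <- r) F i e x).
Proof. by move=> h; apply/small0; apply: small_sum => i; exact/small0. Qed.

Lemma tame_prod (T : Type) (r : seq T) (F : T -> R -> R -> R) :
  (forall i, tame (F i)) -> tame (fun e x => \prod_(i <- r) F i e x).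
Proof.
move=> h; elim: r => [|i r IH].
  by apply: tame_ext (tame_cst 1); apply: near0_all => e x; rewrite big_nil.
by apply: tame_ext (tameM (h i) IH); apply: near0_all => e x; rewrite big_cons.
Qed.

Lemma small_subM m F F' G G' : tame F -> tame G' ->
  small m (fun e x => F e x - F' e x) -> small m (fun e x => G e x - G' e x) ->
  small m (fun e x => F e x * G e x - F' e x * G' e x).
Proof.
move=> tF tG' sF sG.
by apply: small_eq (smallD (smallMl tF sG) (smallMr sF tG')) => e x; ring.
Qed.

Lemma small_sub_prod m (T : Type) (r : seq T) (F F' : T -> R -> R -> R) :
  (forall i, tame (F i)) -> (forall i, tame (F' i)) ->
  (forall i, small m (fun e x => F i e x - F' i e x)) ->
  small m (fun e x => \prod_(i <- r) F i e x - \prod_(i <- r) F' i e x).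
Proof.
move=> tF tF' h; elim: r => [|i r IH].
  by apply: small_eq (small_zero m) => e x; rewrite !big_nil subrr.
apply: small_eq (small_subM (tF i) (tame_prod r tF') (h i) IH) => e x.
by rewrite !big_cons.
Qed.

(** The derivatives of 1/F are polynomials in 1/F and the derivatives of F, so it
    is enough to bound F away from 0. *)
Lemma near_cst_inv F (a : R) : a != 0 -> small 1 (fun e x => F e x - a) ->
  near0 (fun e x => F e x != 0) /\ tame (fun e x => (F e x)^-1).
Proof.
move=> a0 sF.
have b0 : 0 < `|a| / 2 by rewrite divr_gt0 ?normr_gt0.
have lb : near0 (fun e x => `|a| / 2 <= `|F e x|).
  move=> r; have [C hC] := tame_bounded r sF.
  have d0 : 0 < `|a| / 2 / (`|C| + 1) by rewrite divr_gt0// ltr_wpDl.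
  apply: filterS3 hC (nbhs_right_gt 0) (nbhs_right_lt d0) => e h e0 ed x xr.
  have ei : 0 <= e^-1 by rewrite invr_ge0 ltW.
  have := h x xr; rewrite expr1 normrM (ger0_norm ei).
  rewrite ler_pdivrMl// => h1.
  have h2 : e * C <= `|a| / 2.
    move: ed; rewrite ltr_pdivlMr ?ltr_wpDl// => /ltW; apply: le_trans.
    by rewrite ler_wpM2l 1?ltW// (le_lt_trans (ler_norm C))// ltrDl.
  have := ler_normD (F e x) (a - F e x); rewrite addrC subrK (distrC a); lra.
have nz : near0 (fun e x => F e x != 0).
  apply: near0W lb => e x; rewrite -normr_gt0; lra.
split=> // N r.
have tF : tame F.
  have := tameD (small_tame sF) (tame_cst a).
  by apply: tame_ext; apply: near0_all => e x; rewrite subrK.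
have [C hC] := tF N r; have [C' hC'] := ck_boundV N C (`|a| / 2)^-1.
exists C'; apply: filterS3 hC (lb r) (nz r) => e h1 h2 h3.
apply: hC' => // x xr; split; first exact: h3.
rewrite normfV lef_pV2 ?posrE ?h2// normr_gt0; exact: h3.
Qed.

Definition tame_mx m n (A : R -> R -> 'M[R]_(m, n)) : Prop :=
  forall i j, tame (fun e x => A e x i j).

Definition small_mx k m n (A B : R -> R -> 'M[R]_(m, n)) : Prop :=
  forall i j, small k (fun e x => A e x i j - B e x i j).

Lemma tame_det n (A : R -> R -> 'M[R]_n) : tame_mx A -> tame (fun e x => \det (A e x)).
Proof.
move=> tA; apply: tame_sum => s; apply: tameM; first exact: tame_cst.
by apply: tame_prod => i; exact: tA.
Qed.

(** Congruence modulo e^k is compatible with sums and products, of which the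
    determinant is made. *)
Lemma small_sub_det k n (A B : R -> R -> 'M[R]_n) : tame_mx A -> tame_mx B ->
  small_mx k A B -> small k (fun e x => \det (A e x) - \det (B e x)).
Proof.
move=> tA tB AB.
have H (s : {perm 'I_n}) : small k (fun e x => (-1) ^+ s *
    (\prod_i A e x i (s i) - \prod_i B e x i (s i))).
  apply: smallMl; first exact: tame_cst.
  by apply: small_sub_prod => i; [exact: tA|exact: tB|exact: AB].
apply: small_eq (small_sum (index_enum {perm 'I_n}) H) => e x.
by rewrite -sumrB; apply: eq_bigr => s _; rewrite mulrBr.
Qed.

(** By Cramer's rule only the determinant has to be inverted. *)
Lemma tame_invmx n (A : R -> R -> 'M[R]_n) (a : R) : a != 0 -> tame_mx A ->
  small 1 (fun e x => \det (A e x) - a) ->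
  near0 (fun e x => A e x \in unitmx) /\ tame_mx (fun e x => invmx (A e x)).
Proof.
move=> a0 tA sA; have [nz tV] := near_cst_inv a0 sA.
have uA : near0 (fun e x => A e x \in unitmx).
  by apply: near0W nz => e x; rewrite unitmxE unitfE.
split=> // i j.
have tadj : tame (fun e x => (\adj (A e x)) i j).
  have tM : tame_mx (fun e x => row' j (col' i (A e x))).
    move=> p q; apply: tame_ext (tA (lift j p) (lift i q)).
    by apply: near0_all => e x; rewrite !mxE.
  apply: tame_ext (tameM (tame_cst ((-1) ^+ (j + i))) (tame_det tM)).
  by apply: near0_all => e x; rewrite mxE.
apply: tame_ext (tameM tV tadj); apply: near0W uA => e x uA.
by rewrite /invmx uA [RHS]mxE.
Qed.

Lemma small_mulmx k n (A : R -> R -> 'M[R]_n) (b : R -> R -> 'cV[R]_n) :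
  tame_mx A -> (forall i, small k (fun e x => b e x i 0)) ->
  forall i, small k (fun e x => (A e x *m b e x) i 0).
Proof.
move=> tA sb i.
apply: small_eq (small_sum (index_enum 'I_n)
  (fun j => smallMl (tA i j) (sb j))) => e x.
by rewrite mxE.
Qed.

End Families.

(** * The Leibniz formula *)

Section Leibniz.
Variable R : realType.
Implicit Types (f g : R -> R) (x : R).

Lemma ck_bound_dern_derivable N r C f i : ck_bound N r C f -> (i < N)%N ->
  forall x, `|x| < r -> derivable f^`(i) x 1.
Proof.
elim: i N f => [|i IH] [|N] f // Hf iN x xr; first exact: (ck_bound_derivable Hf).
by rewrite derive1nSr; exact: (IH _ _ (ck_bound_derive1 Hf) iN).
Qed.

Lemma leibniz_ball N r C D f g : ck_bound N r C f -> ck_bound N r D g ->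
  forall j, (j <= N)%N -> forall x, `|x| < r ->
  (fun y => f y * g y)^`(j) x =
  \sum_(i < j.+1) 'C(j, i)%:R * f^`(j - i) x * g^`(i) x.
Proof.
move=> Hf Hg; elim=> [|j IH] jN x xr.
  by rewrite big_ord1 bin0 mul1r.
have df i : (i <= j)%N -> derivable f^`(i) x 1.
  by move=> ij; apply: (ck_bound_dern_derivable Hf _ xr); lia.
have dg i : (i <= j)%N -> derivable g^`(i) x 1.
  by move=> ij; apply: (ck_bound_dern_derivable Hg _ xr); lia.
pose S y := \sum_(i < j.+1) 'C(j, i)%:R * f^`(j - i) y * g^`(i) y.
transitivity (S^`() x).
  by rewrite derive1nS; apply: derive1_ext xr; exact: IH (ltnW jN).
have dt (i : 'I_j.+1) :
    derivable (fun y => 'C(j, i)%:R * f^`(j - i) y * g^`(i) y) x 1.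
  apply: derivableM; last by apply: dg; rewrite -ltnS.
  by apply: derivableZc; apply: df; exact: leq_subr.
rewrite derive1_sumf//.
have E (i : 'I_j.+1) : (fun y => 'C(j, i)%:R * f^`(j - i) y * g^`(i) y)^`() x =
    'C(j, i)%:R * f^`(j.+1 - i) x * g^`(i) x + 'C(j, i)%:R * f^`(j - i) x * g^`(i.+1) x.
  have ij : (i <= j)%N by rewrite -ltnS.
  rewrite derive1M ?derive1Z -?derive1nS ?subSn//.
  - by apply: df; exact: leq_subr.
  - by apply: derivableZc; apply: df; exact: leq_subr.
  - exact: dg.
under eq_bigr do rewrite E.
rewrite big_split /= big_ord_recl [in RHS]big_ord_recl /= !bin0 ?subn0 -addrA.
congr (_ + _).
have -> : \sum_(i < j) 'C(j, bump 0 i)%:R * f^`(j.+1 - bump 0 i) x * g^`(bump 0 i) x =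
    \sum_(i < j.+1) 'C(j, i.+1)%:R * f^`(j - i) x * g^`(i.+1) x.
  by rewrite big_ord_recr /= bin_small// !mul0r addr0.
rewrite -big_split /=; apply: eq_bigr => i _.
by rewrite /bump /= add1n binS subSS natrD; ring.
Qed.

Lemma leibniz f g j x : smooth f -> smooth g ->
  (fun y => f y * g y)^`(j) x =
  \sum_(i < j.+1) 'C(j, i)%:R * f^`(j - i) x * g^`(i) x.
Proof.
move=> sf sg; have [C hC] := smooth_ck_bound j (`|x| + 1) sf.
have [D hD] := smooth_ck_bound j (`|x| + 1) sg.
by apply: (leibniz_ball hC hD); rewrite ?ltrDl.
Qed.

(** With a bound independent of j, formulas for several orders of differentiation
    can be added term by term. *)
Lemma leibniz_ball_wide N r C D f g n : ck_bound N r C f -> ck_bound N r D g ->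
  forall j, (j <= N)%N -> (j < n)%N -> forall x, `|x| < r ->
  (fun y => f y * g y)^`(j) x =
  \sum_(i < n) 'C(j, i)%:R * f^`(j - i) x * g^`(i) x.
Proof.
move=> Hf Hg j jN jn x xr; rewrite (leibniz_ball Hf Hg jN xr).
rewrite (big_ord_widen n (fun i => 'C(j, i)%:R * f^`(j - i) x * g^`(i) x) jn).
rewrite big_mkcond; apply: eq_bigr => i _; case: ifP => // /negbT.
by rewrite -leqNgt => ji; rewrite bin_small// !mul0r.
Qed.

Lemma derive1n_ext r f g : (forall y, `|y| < r -> f y = g y) ->
  forall j x, `|x| < r -> f^`(j) x = g^`(j) x.
Proof.
move=> fg; elim=> [|j IH] x xr; first exact: fg.
by rewrite !derive1nS; exact: derive1_ext IH xr.
Qed.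

End Leibniz.

Section SmoothFacts.
Variable R : realType.
Implicit Types (f g : R -> R) (x : R).

Lemma smoothZ (a : R) f : smooth f -> smooth (fun x => a * f x).
Proof. by move=> sf; exact: (smoothM (@smooth_cst R a) sf). Qed.

Lemma derive1n_add j f g x : smooth f -> smooth g ->
  (fun y => f y + g y)^`(j) x = f^`(j) x + g^`(j) x.
Proof.
elim: j f g => [|j IH] f g sf sg //.
rewrite !derive1nSr -IH; [|exact: smooth_derive1..].
congr (derive1n j _ x); apply/funext => y; rewrite derive1D//; exact: smooth_derivable.
Qed.

Lemma derive1n_scale j (a : R) f x : smooth f ->
  (fun y => a * f y)^`(j) x = a * f^`(j) x.
Proof.
elim: j f => [|j IH] f sf //.
rewrite !derive1nSr -IH; last exact: smooth_derive1.
congr (derive1n j _ x); apply/funext => y; rewrite derive1Z//; exact: smooth_derivable.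
Qed.

Lemma derive1n_sum j (T : Type) (s : seq T) (F : T -> R -> R) x :
  (forall i, smooth (F i)) ->
  (fun y => \sum_(i <- s) F i y)^`(j) x = \sum_(i <- s) (F i)^`(j) x.
Proof.
move=> sF; elim: s => [|i s IH].
  under eq_fun do rewrite big_nil.
  by rewrite big_nil derive1n_cst if_same.
under eq_fun do rewrite big_cons.
rewrite derive1n_add ?IH ?big_cons//; apply: smooth_sum => *; exact: sF.
Qed.

Lemma derive1n_comp i j f : (f^`(i))^`(j) = f^`(j + i).
Proof. by rewrite /derive1n iterD. Qed.

End SmoothFacts.

(** * The commutator of Q_2 with the Lax operator *)

Section Commutator.
Variable R : realType.

(** Differential operators of order less than n, seen through their action on
    smooth functions. *)
Definition diffop n (P : (R -> R) -> R -> R) : Prop :=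
  exists2 c : nat -> R -> R, (forall j, smooth (c j)) &
  forall f, smooth f -> forall x, P f x = \sum_(j < n) c j x * f^`(j) x.

Lemma diffop_ext n P P' : (forall f, smooth f -> forall x, P f x = P' f x) ->
  diffop n P -> diffop n P'.
Proof.
by move=> PP' [c sc hc]; exists c => // f sf x; rewrite -PP'// hc.
Qed.

Lemma diffopD n P P' : diffop n P -> diffop n P' ->
  diffop n (fun f x => P f x + P' f x).
Proof.
move=> [c sc hc] [c' sc' hc']; exists (fun j x => c j x + c' j x).
  by move=> j; exact: (smoothD (sc j) (sc' j)).
move=> f sf x; rewrite hc// hc'// -big_split /=.
by apply: eq_bigr => j _; rewrite mulrDl.
Qed.

Lemma diffopM n (v : R -> R) P : smooth v -> diffop n P ->
  diffop n (fun f x => v x * P f x).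
Proof.
move=> sv [c sc hc]; exists (fun j x => v x * c j x).
  by move=> j; exact: (smoothM sv (sc j)).
move=> f sf x; rewrite hc// big_distrr /=.
by apply: eq_bigr => j _; rewrite mulrA.
Qed.

Lemma diffop_term n j : (j < n)%N -> diffop n (fun f => f^`(j)).
Proof.
move=> jn; exists (fun i _ => (i == j)%:R); first by move=> i; exact: smooth_cst.
move=> f sf x; rewrite (bigD1 (Ordinal jn)) //= eqxx mul1r big1 ?addr0// => i.
by rewrite -val_eqE /= => /negbTE ->; rewrite mul0r.
Qed.

Lemma diffop_sum n (I : Type) (r : seq I) (P : I -> (R -> R) -> R -> R) :
  (forall i, diffop n (P i)) -> diffop n (fun f x => \sum_(i <- r) P i f x).
Proof.
move=> h; elim: r => [|i r IH].
  exists (fun _ _ => 0); first by move=> _; exact: smooth_cst.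
  by move=> f sf x; rewrite big_nil big1// => j _; rewrite mul0r.
apply: diffop_ext (diffopD (h i) IH) => f sf x.
by rewrite big_cons.
Qed.

(** Q_2 in closed form; see [square_plusE]. *)
Definition Qop d (u : nat -> R -> R) (f : R -> R) (x : R) : R :=
  f^`(2) x + 2 / d.+1%:R * u d.-1 x * f x.

Lemma smooth_Qop d (u : nat -> R -> R) (f : R -> R) :
  smooth (u d.-1) -> smooth f -> smooth (Qop d u f).
Proof.
move=> su sf.
exact: (smoothD (@smooth_derive1n R f 2 sf) (smoothM (smoothZ su) sf)).
Qed.

Lemma derive1n_Qop d (u : nat -> R -> R) (f : R -> R) j x :
  smooth (u d.-1) -> smooth f ->
  (Qop d u f)^`(j) x = f^`(j.+2) x + 2 / d.+1%:R *
    \sum_(i < j.+1) 'C(j, i)%:R * (u d.-1)^`(j - i) x * f^`(i) x.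
Proof.
set v := u _ => sv sf.
have -> : Qop d u f = (fun y => f^`(2) y + 2 / d.+1%:R * (v y * f y)).
  by apply/funext => y; rewrite /Qop mulrA.
have svf := smoothM sv sf.
rewrite (derive1n_add j x (@smooth_derive1n R f 2 sf) (smoothZ svf)).
by rewrite (derive1n_scale j _ x svf) (leibniz j x sv sf) derive1n_comp addn2.
Qed.

Lemma laxE d (u : nat -> R -> R) (f : R -> R) x :
  lax d u f x = f^`(d.+1) x + \sum_(j < d) u j x * f^`(j) x.
Proof. by []. Qed.

(** The terms of order above d cancel for any multiple of u_(d-1) in Q.  In order d,
    the bracket of d^2 with u_(d-1) d^(d-1) contributes 2 u_(d-1)', that of
    a u_(d-1) with d^(d+1) contributes - a (d+1) u_(d-1)', and a = 2/(d+1). *)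
Lemma commutator_diffop d (u : nat -> R -> R) : (2 <= d)%N ->
  (forall j, (j < d)%N -> smooth (u j)) ->
  diffop d (fun f x => Qop d u (lax d u f) x - lax d u (Qop d u f) x).
Proof.
case: d => // n n1 su; set d := n.+1.
set a : R := 2 / d.+1%:R; pose v := u n.
have sv : smooth v by apply: su.
have sum_d (j : 'I_d) : smooth (u j) by apply: su.
pose P1 (f : R -> R) x := \sum_(j < d) (u j)^`(2) x * f^`(j) x.
pose P2 (f : R -> R) x := \sum_(j < n) (2 * (u j)^`() x) * f^`(j.+1) x.
pose P3 (f : R -> R) x := \sum_(j < d) (- a * ('C(d.+1, j)%:R * v^`(d.+1 - j) x)) * f^`(j) x.
pose P4 (f : R -> R) x := \sum_(j < d) (- a * u j x) *
   (\sum_(i < j) ('C(j, i)%:R * v^`(j - i) x) * f^`(i) x).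
have d1 : diffop d P1.
  apply: diffop_sum => j.
  apply: (diffopM (@smooth_derive1n R (u j) 2 (sum_d j))).
  exact: diffop_term.
have d2 : diffop d P2.
  apply: diffop_sum => j; apply: diffopM; last first.
    by apply: diffop_term; exact: (ltn_ord j).
  apply: smoothZ; apply: smooth_derive1; apply: su.
  exact: ltn_trans (ltn_ord j) _.
have d3 : diffop d P3.
  apply: diffop_sum => j; apply: diffopM; last exact: diffop_term.
  by do 2 apply: smoothZ; exact: smooth_derive1n.
have d4 : diffop d P4.
  apply: diffop_sum => j; apply: (diffopM (smoothZ (sum_d j))).
  apply: diffop_sum => i.
  apply: (diffopM (smoothZ (@smooth_derive1n R v (j - i) sv))).
  by apply: diffop_term; exact: ltn_trans (ltn_ord i) (ltn_ord j).
apply: diffop_ext (diffopD (diffopD d1 d2) (diffopD d3 d4)) => f sf x.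
have sfj j : smooth f^`(j) by exact: smooth_derive1n.
have suf (j : 'I_d) : smooth (fun y => u j y * f^`(j) y).
  exact: (smoothM (sum_d j) (sfj j)).
have sL : smooth (fun y => \sum_(j < d) u j y * f^`(j) y) by apply: smooth_sum => j _; exact: (suf j).
have EQL : Qop d u (lax d u f) x = f^`(d.+3) x +
   \sum_(j < d) ((u j)^`(2) x * f^`(j) x + 2 * (u j)^`() x * f^`(j.+1) x + u j x * f^`(j.+2) x)
   + a * v x * (f^`(d.+1) x + \sum_(j < d) u j x * f^`(j) x).
  rewrite /Qop; congr (_ + _).
  have -> : lax d u f = (fun y => f^`(d.+1) y + \sum_(j < d) u j y * f^`(j) y) by [].
  rewrite (derive1n_add 2 x (sfj d.+1) sL) derive1n_comp; congr (_ + _).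
  rewrite (derive1n_sum 2 _ x suf).
  apply: eq_bigr => j _; rewrite (leibniz 2 x (sum_d j) (sfj j)) 3!big_ord_recr big_ord0 /=.
  rewrite bin0 bin1 binn.
  move: (derive1 (derive1 (u j)) x) (derive1 (u j) x) => p q.
  by move: (derive1n j f x) (derive1 (derive1n j f) x)
    (derive1 (derive1 (derive1n j f)) x) => a0 a1 a2; ring.
have EQ j := @derive1n_Qop d u f j x sv sf.
rewrite EQL laxE EQ -/v -/a.
pose C := \sum_(j < d) u j x * f^`(j.+2) x.
pose S := \sum_(j < d) u j x * f^`(j) x.
pose B := \sum_(i < d) 'C(d.+1, i)%:R * v^`(d.+1 - i) x * f^`(i) x.
have H1 : \sum_(j < d) ((u j)^`(2) x * f^`(j) x + 2 * (u j)^`() x * f^`(j.+1) x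
    + u j x * f^`(j.+2) x) = P1 f x + (P2 f x + 2 * v^`() x * f^`(d) x) + C.
  rewrite !big_split /=; congr (_ + _ + _).
  by rewrite [LHS]big_ord_recr.
have H2 : \sum_(i < d.+2) 'C(d.+1, i)%:R * v^`(d.+1 - i) x * f^`(i) x =
    B + d.+1%:R * v^`() x * f^`(d) x + v x * f^`(d.+1) x.
  rewrite 2!big_ord_recr; congr (_ + _ + _).
    by rewrite [nat_of_ord _]/= subSnn derive1n1 -bin_sub// subSnn bin1.
  by rewrite [nat_of_ord _]/= subnn binn derive1n0 mul1r.
have H3 : P3 f x = - a * B.
  by rewrite /P3 /B big_distrr /=; apply: eq_bigr => i _; rewrite !mulrA.
have H4 : \sum_(j < d) u j x * (Qop d u f)^`(j) x = C + a * v x * S - P4 f x.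
  rewrite /C /S /P4 big_distrr -sumrN -!big_split /=.
  apply: eq_bigr => j _; rewrite EQ -/v -/a big_ord_recr /= binn subnn derive1n0.
  by move: (\sum_(i < j) _) => T; ring.
rewrite H1 H2 H3 H4 -/S.
have ad : a * d.+1%:R = 2 by rewrite /a divfK// pnatr_eq0.
have -> : 2 * v^`() x * f^`(d) x = a * d.+1%:R * v^`() x * f^`(d) x by rewrite ad.
move: (derive1 v x) (derive1n d f x) (derive1n d.+1 f x) (derive1n d.+3 f x).
move: (P1 f x) (P2 f x) (P4 f x) => p1 p2 p4 v1 f0 f1 f3.
ring.
Qed.

End Commutator.

(** * The polynomial vanishing at the shifts *)

Section Interpolation.
Variable R : realType.
Variable k : nat -> R.

Definition nodes n : {poly R} := \prod_(l < n) ('X - (k l)%:P).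

Lemma nodesS n : nodes n.+1 = nodes n * ('X - (k n)%:P).
Proof. by rewrite /nodes big_ord_recr. Qed.

Lemma coef_nodesS n i : (nodes n.+1)`_i.+1 = (nodes n)`_i - (nodes n)`_i.+1 * k n.
Proof. by rewrite nodesS mulrBr coefB coefMX coefMC. Qed.

Lemma coef0_nodesS n : (nodes n.+1)`_0 = - (nodes n)`_0 * k n.
Proof. by rewrite nodesS mulrBr coefB coefMX coefMC /= sub0r mulNr. Qed.

Lemma size_nodes n : size (nodes n) = n.+1.
Proof. by rewrite /nodes size_prod_XsubC [index_enum _]unlock -enumT size_enum_ord. Qed.

Lemma coef_nodes_top n : (nodes n)`_n = 1.
Proof.
have /monicP := monic_prod_XsubC (index_enum 'I_n) xpredT (fun l : 'I_n => k l).
by rewrite /lead_coef size_nodes.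
Qed.

Lemma coef_nodes_sum n : (nodes n.+1)`_n = - \sum_(l < n.+1) k l.
Proof.
elim: n => [|n IH]; first by rewrite coef0_nodesS coef_nodes_top big_ord1 mulN1r.
by rewrite coef_nodesS IH coef_nodes_top [in RHS]big_ord_recr /= opprD mul1r.
Qed.

(** Newton's identity for the second elementary symmetric function. *)
Lemma coef_nodes_sum2 n :
  2 * (nodes n.+2)`_n = (\sum_(l < n.+2) k l) ^+ 2 - \sum_(l < n.+2) k l ^+ 2.
Proof.
elim: n => [|n IH].
  by rewrite coef0_nodesS coef_nodes_sum !big_ord_recr !big_ord0 /=; ring.
rewrite coef_nodesS mulrBr IH coef_nodes_sum.
by rewrite [in RHS]big_ord_recr [X in _ = _ - X]big_ord_recr /=; ring.
Qed.

Lemma nodes_root n l : (l < n)%N -> (nodes n).[k l] = 0.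
Proof.
move=> ln; rewrite /nodes horner_prod (bigD1 (Ordinal ln)) //=.
by rewrite hornerXsubC subrr mul0r.
Qed.

Lemma nodes_interp n l : (l < n)%N ->
  \sum_(i < n) (nodes n)`_i * k l ^+ i = - k l ^+ n.
Proof.
move=> ln; have := nodes_root ln.
rewrite (@horner_coef_wide _ n.+1) ?size_nodes// big_ord_recr /= coef_nodes_top mul1r.
by move/eqP; rewrite addr_eq0 => /eqP.
Qed.

(** The leading part of the system expressing that a covector annihilates the
    vertices: row l lists the Taylor coefficients of the shift by k_l. *)
Definition vander n : 'M[R]_n := \matrix_(l, i) (k l ^+ i / (i`!)%:R).

Lemma det_vander n : (forall i j, (i < j < n)%N -> k i < k j) ->
  \det (vander n) != 0.
Proof.
move=> hk.
have -> : vander n = (Vandermonde n (\row_(l < n) k l))^T *m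
    diag_mx (\row_(i < n) ((i`!)%:R^-1)).
  apply/matrixP => l i; rewrite mul_mx_diag !mxE.
  by [].
rewrite det_mulmx det_tr det_Vandermonde det_diag mulf_neq0//.
  apply/prodf_neq0 => i _; apply/prodf_neq0 => j ij.
  by rewrite !mxE subr_eq0 gt_eqF// hk// ij /=.
by apply/prodf_neq0 => i _; rewrite mxE invr_eq0 pnatr_eq0 -lt0n fact_gt0.
Qed.

End Interpolation.

(** * Pairings of derivatives of a covector and a vector *)

Section Pairing.
Variables (R : realType) (p : nat).
Implicit Types F K : 'I_p -> R -> R -> R.

Definition pairing F K (i j : nat) (e x : R) : R :=
  \sum_m (F m e)^`(i) x * (K m e)^`(j) x.

Lemma derive1_pairing F K i j :
  (forall m i, near0 (fun e x => derivable (F m e)^`(i) x 1)) ->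
  (forall m j, near0 (fun e x => derivable (K m e)^`(j) x 1)) ->
  near0 (fun e x => (pairing F K i j e)^`() x =
                  pairing F K i.+1 j e x + pairing F K i j.+1 e x).
Proof.
move=> dF dK; apply: near0_2 (near0_forall (fun m => dF m i)) (near0_forall (fun m => dK m j)).
move=> e x hF hK; rewrite /pairing.
rewrite (@derive1_sumf R _ (index_enum 'I_p)
  (fun m y => (F m e)^`(i) y * (K m e)^`(j) y)).
  by rewrite -big_split /=; apply: eq_bigr => m _; rewrite derive1M// !derive1nS.
by move=> m; exact: (derivableM (hF m) (hK m)).
Qed.

Lemma tame_pairing F K i j : (forall m, tame (F m)) -> (forall m, tame (K m)) ->
  tame (pairing F K i j).
Proof.
move=> tF tK; apply: tame_sum => m.
exact: (tameM (tame_derive1n i (tF m)) (tame_derive1n j (tK m))).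
Qed.

Lemma tame_derivable_dern (F : R -> R -> R) i : tame F ->
  near0 (fun e x => derivable (F e)^`(i) x 1).
Proof. by move=> tF; apply: tame_derivable; exact: tame_derive1n. Qed.

(** Induction on i, since <F^(i+1), K^(j)> = <F^(i), K^(j)>' - <F^(i), K^(j+1)>. *)
Lemma small_pairing s q F K : (forall m, tame (F m)) -> (forall m, tame (K m)) ->
  (forall j, (j < q)%N -> small s (pairing F K 0 j)) ->
  forall i j, (i + j < q)%N -> small s (pairing F K i j).
Proof.
move=> tF tK h0; elim=> [|i IH] j ijq; first exact: h0.
have h1 : small s (pairing F K i j) by apply: IH; lia.
have h2 : small s (pairing F K i j.+1) by apply: IH; lia.
apply: small_ext (smallB (small_derive1 h1) h2).
apply: near0W (derive1_pairing i j (fun m i => tame_derivable_dern i (tF m))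
  (fun m i => tame_derivable_dern i (tK m))) => e x ->.
by rewrite addrK.
Qed.

(** On the antidiagonal i + j = q, moving one derivative from K to F changes the
    sign, as the pairings with i + j = q - 1 are negligible. *)
Lemma small_pairing_diag q F K : (forall m, tame (F m)) -> (forall m, tame (K m)) ->
  (forall j, (j < q)%N -> small 1 (pairing F K 0 j)) ->
  small 1 (fun e x => pairing F K 0 q e x - 1) ->
  forall i, (i <= q)%N ->
  small 1 (fun e x => pairing F K i (q - i) e x - (-1) ^+ i).
Proof.
move=> tF tK h0 h1; elim=> [|i IH] iq; first by rewrite subn0 expr0.
have h2 : small 1 (pairing F K i (q - i.+1)).
  by apply: (small_pairing tF tK h0); lia.
have E : (q - i)%N = (q - i.+1).+1 by lia.
apply: small_ext (smallB (small_derive1 h2) (IH (ltnW iq))).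
apply: near0W (derive1_pairing i (q - i.+1) (fun m i => tame_derivable_dern i (tF m))
  (fun m i => tame_derivable_dern i (tK m))) => e x ->.
by rewrite E exprS; ring.
Qed.

Lemma pairing_zero q F K :
  (forall m i, near0 (fun e x => derivable (F m e)^`(i) x 1)) ->
  (forall m j, near0 (fun e x => derivable (K m e)^`(j) x 1)) ->
  (forall j, (j < q)%N -> near0 (fun e x => pairing F K 0 j e x = 0)) ->
  forall i j, (i + j < q)%N -> near0 (fun e x => pairing F K i j e x = 0).
Proof.
move=> dF dK h0; elim=> [|i IH] j ijq; first exact: h0.
have h1 : near0 (fun e x => pairing F K i j e x = 0) by apply: IH; lia.
have h2 : near0 (fun e x => pairing F K i j.+1 e x = 0) by apply: IH; lia.
have h3 : near0 (fun e x => (pairing F K i j e)^`() x = 0).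
  apply: near0W (@near0_derive1 R _ (fun _ _ => 0) h1) => e x ->.
  exact: derive1_cst.
apply: near0_3 h2 h3 (derive1_pairing i j dF dK) => e x -> ->.
by rewrite addr0.
Qed.

End Pairing.

(** Here b j, E j and yv j stand for the j-th derivatives of a multiplier, of a
    curve and of their product.  If the curve satisfies
    E^(d+1) = sum_(i <= d) s_i E^(i) - sum_(j < d) uu_j E^(j), these are the
    coefficients of (b E)^(d+1) + sum_(j < d) v_j (b E)^(j) on the E^(i), i <= d.
    The one for i = d contains b' but none of the v_j. *)
Definition top_relation (R : realType) d (b v uu s : nat -> R) (i : nat) : R :=
  if (i < d)%N then 'C(d.+1, i)%:R * b (d.+1 - i)%N
     + \sum_(j < d) v j * ('C(j, i)%:R * b (j - i)%N) + b 0%N * (s i - uu i)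
  else d.+1%:R * b 1%N + b 0%N * s i.

Lemma top_relationP (R : realType) d (b v uu s E yv : nat -> R) :
  (forall j, (j <= d.+1)%N ->
    yv j = \sum_(i < d.+2) 'C(j, i)%:R * b (j - i)%N * E i) ->
  yv d.+1 + \sum_(j < d) v j * yv j = 0 ->
  \sum_(i < d.+1) E i * s i = E d.+1 + \sum_(j < d) uu j * E j ->
  \sum_(i < d.+1) E i * top_relation d b v uu s i = 0.
Proof.
move=> yE ly sE.
have yl (j : 'I_d) : yv j = \sum_(i < d) 'C(j, i)%:R * b (j - i)%N * E i.
  have jd := ltn_ord j.
  rewrite yE 1?ltnW// 1?ltnW// 2!big_ord_recr /= bin_small// bin_small 1?ltnW//.
  by rewrite !mul0r !addr0.
move: ly; under eq_bigr do rewrite yl mulr_sumr.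
rewrite exchange_big yE// 2!big_ord_recr /= binn subnn mul1r subSnn.
rewrite -bin_sub// subSnn bin1 => ly.
move: sE; rewrite big_ord_recr /= => sE.
rewrite big_ord_recr /= [X in _ + _ * X]/top_relation ltnn.
have -> : \sum_(i < d) E i * top_relation d b v uu s i =
   \sum_(i < d) 'C(d.+1, i)%:R * b (d.+1 - i)%N * E i
   + \sum_(i < d) \sum_(j < d) v j * ('C(j, i)%:R * b (j - i)%N * E i)
   + b 0%N * (\sum_(i < d) E i * s i) - b 0%N * (\sum_(i < d) uu i * E i).
  rewrite !mulr_sumr -sumrN -!big_split /=; apply: eq_bigr => i _.
  rewrite /top_relation ltn_ord.
  have -> : \sum_(j < d) v j * ('C(j, i)%:R * b (j - i)%N * E i) =
      E i * \sum_(j < d) v j * ('C(j, i)%:R * b (j - i)%N).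
    by rewrite mulr_sumr; apply: eq_bigr => j _; ring.
  by move: (\sum_(j < d) _) => S; ring.
have -> : \sum_(i < d) E i * s i = E d.+1 + \sum_(j < d) uu j * E j - E d * s d.
  by rewrite -sE addrK.
rewrite -[RHS]ly.
move: (\sum_(i < d) _) (\sum_(i < d) _) (\sum_(i < d) _) => S1 S2 S3.
by rewrite -natr1; ring.
Qed.

(** * The hyperplane through the vertices *)

Section Curve.
Variables (R : realType) (n : nat).
Local Notation d := n.+2.
Variables (k : nat -> R) (g : 'I_d.+1 -> R -> R) (u : nat -> R -> R).
Hypothesis k_incr : forall i j, (i < j < d)%N -> k i < k j.
Hypothesis k_sum : \sum_(l < d) k l = 0.
Hypothesis smooth_g : forall m, smooth (g m).
Hypothesis smooth_u : forall j, (j < d)%N -> smooth (u j).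
Hypothesis lax_g : forall m x, lax d u (g m) x = 0.

Definition wmx x : 'M[R]_d.+1 := \matrix_(i, j) (g i)^`(j) x.
Hypothesis det_wmx : forall x, \det (wmx x) = 1.

Lemma wmx_unit x : wmx x \in unitmx.
Proof. by rewrite unitmxE det_wmx unitr1. Qed.

Lemma tame_g m j : tame (fun _ => (g m)^`(j)).
Proof. exact: (tame_smooth (@smooth_derive1n R (g m) j (@smooth_g m))). Qed.

(** The basis dual to g, g', ..., g^(d), whose members are the rows of the inverse of
    the Wronskian matrix.  The index is a natural number, to be used for i <= d. *)
Definition eta (i : nat) (m : 'I_d.+1) (x : R) : R := invmx (wmx x) (inord i) m.

Lemma tame_eta i m : tame (fun _ => eta i m).
Proof.
have tW : @tame_mx R d.+1 d.+1 (fun _ x => wmx x).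
  by move=> p q; apply: tame_ext (tame_g p q); apply: near0_all => e x; rewrite mxE.
have h : small 1 (fun _ x : R => \det (wmx x) - 1).
  by apply: small_eq (@small_zero R 1) => e x; rewrite det_wmx subrr.
by have [_] := tame_invmx (oner_neq0 R) tW h; exact.
Qed.

Definition eta_g i j (x : R) : R := \sum_m eta i m x * (g m)^`(j) x.

Lemma eta_g_low i j x : (i <= d)%N -> (j <= d)%N -> eta_g i j x = (i == j)%:R.
Proof.
move=> id jd; have := mulVmx (wmx_unit x).
move=> /(congr1 (fun A : 'M[R]_d.+1 => A (inord i) (inord j))).
rewrite !mxE -val_eqE /= !inordK// => <-.
by apply: eq_bigr => m _; rewrite /eta !mxE inordK.
Qed.

(** For i = d this vanishes, because the equation of g has no term of order d. *)
Lemma eta_g_top i x : (i <= d)%N -> eta_g i d.+1 x = - ((i < d)%:R * u i x).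
Proof.
move=> id; rewrite /eta_g.
have E m : (g m)^`(d.+1) x = - \sum_(j < d) u j x * (g m)^`(j) x.
  by apply/eqP; rewrite -addr_eq0; apply/eqP; exact: (lax_g m x).
under eq_bigr do rewrite E mulrN mulr_sumr.
rewrite sumrN exchange_big /=; congr (- _).
transitivity (\sum_(j < d) u j x * eta_g i j x).
  by apply: eq_bigr => j _; rewrite mulr_sumr; apply: eq_bigr => m _; ring.
have [idl|idl] := boolP (i < d)%N.
  rewrite (bigD1 (Ordinal idl)) //= eta_g_low// ?(ltnW idl)// eqxx mulr1 mul1r.
  rewrite big1 ?addr0// => j; rewrite -val_eqE /= => ji.
  by rewrite eta_g_low// 1?ltnW// eq_sym (negbTE ji) mulr0.
rewrite mul0r big1// => j _; rewrite eta_g_low// 1?ltnW//.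
case: eqP => [ij|_]; last by rewrite mulr0.
by move: idl; rewrite ij ltn_ord.
Qed.

Definition vert i l (e x : R) : R := \sum_m eta i m x * g m (x + k l * e).

(** Taylor's formula at order d + 1.  The first correction has order d + 1, which is
    enough when i < d; when i = d it vanishes by [eta_g_top], and the remainder of
    order d + 2 is left. *)
Lemma small_vert i l : (i <= d)%N ->
  small i.+2 (fun e x => vert i l e x - (k l * e) ^+ i / (i`!)%:R).
Proof.
move=> id.
have E e x : vert i l e x - (k l * e) ^+ i / (i`!)%:R =
    e ^+ d.+1 * (k l ^+ d.+1 / (d.+1`!)%:R * - ((i < d)%:R * u i x))
    + \sum_m eta i m x * taylor_rem d.+2 (g m) (k l * e) x.
  have T m : g m (x + k l * e) =
      \sum_(j < d.+2) (k l * e) ^+ j / (j`!)%:R * (g m)^`(j) x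
      + taylor_rem d.+2 (g m) (k l * e) x.
    by rewrite /taylor_rem [RHS]addrC subrK.
  rewrite /vert; under eq_bigr do rewrite T mulrDr mulr_sumr.
  rewrite big_split /= exchange_big /= addrAC; congr (_ + _).
  have S (j : 'I_d.+2) : \sum_m eta i m x * ((k l * e) ^+ j / (j`!)%:R * (g m)^`(j) x)
      = (k l * e) ^+ j / (j`!)%:R * eta_g i j x.
    by rewrite mulr_sumr; apply: eq_bigr => m _; ring.
  under eq_bigr do rewrite S.
  rewrite big_ord_recr /= eta_g_top// (bigD1 (Ordinal (id : i < d.+1)%N)) //=.
  rewrite eta_g_low// eqxx mulr1 big1 ?addr0.
    by rewrite addrC addrA addNr add0r exprMn; ring.
  move=> j; rewrite -val_eqE /= => ji; rewrite eta_g_low ?leq_ord//.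
  by rewrite eq_sym (negbTE ji) mulr0.
have s2 : small d.+2 (fun e x => \sum_m eta i m x * taylor_rem d.+2 (g m) (k l * e) x).
  apply: small_sum => m; apply: (smallMl (tame_eta i m)).
  exact: tame_taylor_rem (@smooth_g m).
have tu : tame (fun (_ : R) x => (i < d)%:R * u i x).
  have [idl|_] := boolP (i < d)%N.
    exact: (tameM (tame_cst 1) (tame_smooth (smooth_u idl))).
  apply: tame_ext (tame_cst 0); apply: near0_all => e x; by rewrite mul0r.
have s1 : small i.+2 (fun e x => e ^+ d.+1 *
    (k l ^+ d.+1 / (d.+1`!)%:R * - ((i < d)%:R * u i x))).
  have [idl|idl] := boolP (i < d)%N.
    apply: (@smallW _ _ d.+1); first by lia.
    apply: (smallMr (@small_pow R d.+1)); apply: (tameM (tame_cst _)).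
    by have := smallN ((small0 _).2 (tame_smooth (smooth_u idl)));
      move/small0; apply: tame_ext; apply: near0_all => e x; rewrite mul1r.
  by apply: small_eq (@small_zero R i.+2) => e x; rewrite mul0r oppr0 !mulr0.
have := smallD s1 (smallW (_ : i.+2 <= d.+2)%N s2).
by move=> /(_ id); apply: small_eq => e x; rewrite E.
Qed.

(** The covector is sought as eta_d + sum_(i < d) e^(d-i) a_i eta_i.  The conditions
    that it annihilate the vertices, divided by e^d, are the system
    [vert_mx *m a = vert_rhs], which has a limit as e tends to 0. *)
Definition vert_mx (e x : R) : 'M[R]_d := \matrix_(l, i) (e ^- i * vert i l e x).
Definition vert_rhs (e x : R) : 'cV[R]_d := \col_l (- (e ^- d * vert d l e x)).
Definition covec_coef e x : 'cV[R]_d := invmx (vert_mx e x) *m vert_rhs e x.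
(** The limit of the coefficients, read off from the polynomial prod_l (t - k_l)/d!. *)
Definition covec_coef0 : 'cV[R]_d := \col_i ((i`!)%:R / (d`!)%:R * (nodes k d)`_i).

Lemma small_vert_scaled i l : (i <= d)%N ->
  small 2 (fun e x => e ^- i * vert i l e x - k l ^+ i / (i`!)%:R).
Proof.
move=> id; apply: tame_ext (small_vert l id).
apply: near0W (@near0_gt0 R) => e x e0; have e1 : e != 0 by rewrite gt_eqF.
have ei j : e ^+ j != 0 by rewrite expf_neq0.
have -> : e ^- i.+2 = e ^- 2 * e ^- i by rewrite -invfM -exprD.
rewrite -mulrA; congr (_ * _); rewrite mulrBr exprMn; congr (_ - _).
have f0 : (i`!)%:R != 0 :> R by rewrite pnatr_eq0 -lt0n fact_gt0.
move: (i`!)%:R f0 (e ^+ i) (ei i) => a a0 b b0.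
by field; rewrite a0 b0.
Qed.

Lemma small_vert_mx : small_mx 2 vert_mx (fun _ _ => vander k d).
Proof.
move=> l i; have id : (i <= d)%N by rewrite ltnW.
by apply: small_eq (small_vert_scaled l id) => e x; rewrite !mxE.
Qed.

Lemma tame_small_sub s (F : R -> R -> R) (f : R -> R -> R) :
  small s (fun e x => F e x - f e x) -> tame f -> tame F.
Proof.
move=> /small_tame sF tf; apply: tame_ext (tameD sF tf).
by apply: near0_all => e x; rewrite subrK.
Qed.

Lemma tame_vert_mx : tame_mx vert_mx.
Proof. by move=> l i; apply: tame_small_sub (small_vert_mx l i) (tame_cst _). Qed.

Lemma vert_mx_inv : near0 (fun e x => vert_mx e x \in unitmx) /\
  tame_mx (fun e x => invmx (vert_mx e x)).
Proof.
apply: (tame_invmx (det_vander k_incr) tame_vert_mx).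
apply: (@smallW _ _ 2) => //.
apply: (small_sub_det tame_vert_mx _ small_vert_mx) => i j; exact: tame_cst.
Qed.

Lemma vander_covec_coef0 : vander k d *m covec_coef0 = \col_l (- (k l ^+ d / (d`!)%:R)).
Proof.
apply/colP => l; rewrite !mxE -mulNr -(nodes_interp k (ltn_ord l)) mulr_suml.
apply: eq_bigr => i _; rewrite !mxE.
have f0 : (i`!)%:R != 0 :> R by rewrite pnatr_eq0 -lt0n fact_gt0.
have f1 : (d`!)%:R != 0 :> R by rewrite pnatr_eq0 -lt0n fact_gt0.
by move: (i`!)%:R (d`!)%:R f0 f1 => a b a0 b0; field; rewrite a0 b0.
Qed.

Lemma small_covec_coef i : small 2 (fun e x => covec_coef e x i 0 - covec_coef0 i 0).
Proof.
have [uG tG] := vert_mx_inv.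
have h (l : 'I_d) : small 2 (fun e x => (vert_rhs e x - vert_mx e x *m covec_coef0) l 0).
  have h1 := smallN (small_vert_scaled l (leqnn d)).
  have h2 : small 2 (fun e x => ((vert_mx e x - vander k d) *m covec_coef0) l 0).
    apply: small_eq (small_sum (index_enum 'I_d)
      (fun i => smallMr (small_vert_mx l i) (tame_cst (covec_coef0 i 0)))) => e x.
    by rewrite mxE; apply: eq_bigr => j _; rewrite !mxE.
  apply: small_eq (smallB h1 h2) => e x.
  rewrite mulmxBl vander_covec_coef0 !mxE; ring.
apply: small_ext (small_mulmx tG h i); apply: near0W uG => e x uG.
by rewrite mulmxBr mulKmx// !mxE.
Qed.

Definition covec m e x : R :=
  eta d m x + \sum_(i < d) e ^+ (d - i) * covec_coef e x i 0 * eta i m x.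

Lemma tame_covec_coef i : tame (fun e x => covec_coef e x i 0).
Proof. exact: tame_small_sub (small_covec_coef i) (tame_cst _). Qed.

Lemma tame_covec m : tame (covec m).
Proof.
apply: (tameD (tame_eta d m)); apply: tame_sum => i.
exact: (tameM (tameM (@tame_pow R (d - i)) (tame_covec_coef i)) (tame_eta i m)).
Qed.

Definition kappa : R := covec_coef0 (inord n) 0.

(** As sum_l k_l = 0, twice the second elementary symmetric function of the k_l is
    - sum_l k_l^2, and the k_l are not all zero. *)
Lemma kappa_lt0 : kappa < 0.
Proof.
rewrite /kappa mxE inordK//.
have f j : 0 < (j`!)%:R :> R by rewrite ltr0n fact_gt0.
rewrite pmulr_rlt0; last by rewrite divr_gt0.
have := coef_nodes_sum2 k n; rewrite k_sum expr0n /= sub0r.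
have sq0 : 0 < \sum_(l < d) k l ^+ 2.
  rewrite lt_neqAle eq_sym psumr_neq0 => [|l _]; last exact: sqr_ge0.
  rewrite sumr_ge0 ?andbT => [|l _]; last exact: sqr_ge0.
  apply/hasP.
  have [k0|k0] := eqVneq (k 0%N) 0.
    exists (Ordinal (isT : 1 < d)%N); rewrite ?mem_index_enum//=.
    by rewrite exprn_even_gt0//= gt_eqF// -k0 k_incr.
  exists ord0; rewrite ?mem_index_enum//=.
  by rewrite exprn_even_gt0.
lra.
Qed.

(** The index d - 1 gives no term of order e because sum_l k_l = 0, and the indices
    below d - 2 only contribute to order e^3 and higher. *)
Lemma small_covec m :
  small 3 (fun e x => covec m e x - (eta d m x + e ^+ 2 * (kappa * eta n m x))).
Proof.
pose q (i : 'I_d) e x : R := e ^+ (d - i) * covec_coef e x i 0 * eta i m x -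
   (i == inord n :> 'I_d)%:R * (e ^+ 2 * (kappa * eta n m x)).
have sq i : small 3 (q i).
  have [->|iN] := eqVneq i (inord n).
    have h := smallMr (small_powM 2 (small_covec_coef (inord n))) (tame_eta n m).
    apply: small_eq (smallW (_ : 3 <= 4)%N h) => // e x.
    have dn : (d - n)%N = 2%N by lia.
    by rewrite /q /kappa eqxx mulr1n inordK// dn; ring.
  have [iE|iE] := eqVneq (i : nat) n.+1.
    have a0 : covec_coef0 i 0 = 0.
      by rewrite mxE iE coef_nodes_sum k_sum oppr0 mulr0.
    have h := smallMr (small_powM 1 (small_covec_coef i)) (tame_eta i m).
    apply: small_eq h => e x.
    by rewrite /q (negbTE iN) a0 iE subSnn mulr0n; ring.
  have iN' : (i : nat) != n.
    by apply: contra iN => /eqP iN; apply/eqP/val_inj; rewrite /= inordK.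
  (* i < d - 2: the power of e is at least 3 *)
  have h := smallMr (smallMr (@small_pow R (d - i)) (tame_covec_coef i)) (tame_eta i m).
  have le : (3 <= d - i)%N by have := ltn_ord i; move: iE iN' => /eqP ? /eqP ?; lia.
  by apply: small_eq (smallW le h) => e x; rewrite /q (negbTE iN) mul0r subr0.
apply: small_eq (small_sum (index_enum 'I_d) sq) => e x.
rewrite /q /covec sumrB -mulr_suml.
have -> : \sum_(i < d) (i == inord n :> 'I_d)%:R = 1 :> R.
  by rewrite (bigD1 (inord n)) //= eqxx big1 ?addr0// => i /negbTE ->.
ring.
Qed.

Lemma covec_vert : near0 (fun e x => forall l : 'I_d,
  \sum_m covec m e x * g m (x + k l * e) = 0).
Proof.
have [uG _] := vert_mx_inv.
apply: near0_2 (@near0_gt0 R) uG => e x e0 uG l.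
have ei j : e ^+ j != 0 by rewrite expf_neq0// gt_eqF.
have -> : \sum_m covec m e x * g m (x + k l * e) =
    vert d l e x + \sum_(i < d) e ^+ (d - i) * covec_coef e x i 0 * vert i l e x.
  rewrite /covec; under eq_bigr do rewrite mulrDl mulr_suml.
  rewrite big_split /= exchange_big /=; congr (_ + _).
  by apply: eq_bigr => i _; rewrite mulr_sumr; apply: eq_bigr => m _; ring.
have : (vert_mx e x *m covec_coef e x) l 0 = vert_rhs e x l 0 by rewrite mulKVmx.
rewrite !mxE => h.
have -> : vert d l e x = e ^+ d * (e ^- d * vert d l e x) by rewrite mulVKf.
rewrite -[_ * vert d l e x]opprK -h mulrN mulr_sumr -sumrN -big_split /=.
rewrite big1// => i _; rewrite mxE.
have -> : e ^+ d = e ^+ (d - i) * e ^+ i.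
  by rewrite -exprD subnK// ltnW.
by field.
Qed.

Lemma covec_top e x : \sum_m covec m e x * (g m)^`(d) x = 1.
Proof.
rewrite /covec; under eq_bigr do rewrite mulrDl mulr_suml.
rewrite big_split /= exchange_big /= [X in X + _](_ : _ = eta_g d d x)//.
rewrite eta_g_low// eqxx big1 ?addr0// => i _.
transitivity (e ^+ (d - i) * covec_coef e x i 0 * eta_g i d x).
  rewrite /eta_g mulr_sumr; apply: eq_bigr => m _; rewrite -!mulrA.
  by [].
by rewrite eta_g_low ?(ltnW (ltn_ord i))// (ltn_eqF (ltn_ord i)) mulr0.
Qed.

(** The covectors annihilating the d vertices form a line transverse to the
    hyperplane of covectors annihilating g^(d). *)
Lemma vert_kernel : near0 (fun e x => forall y : 'rV[R]_d.+1,
  (forall l : 'I_d, \sum_m y 0 m * g m (x + k l * e) = 0) ->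
  \sum_m y 0 m * (g m)^`(d) x = 0 -> y = 0).
Proof.
have [uG _] := vert_mx_inv.
apply: near0_2 (@near0_gt0 R) uG => e x e0 uG y yv yd.
have ei j : e ^+ j != 0 by rewrite expf_neq0// gt_eqF.
have [z zE] : exists z, z = y *m wmx x by eexists.
have zd : z 0 (inord d) = 0.
  by rewrite zE mxE -[RHS]yd; apply: eq_bigr => m _; rewrite mxE inordK.
have yE m : y 0 m = \sum_(i < d.+1) z 0 i * eta i m x.
  have -> : y = z *m invmx (wmx x) by rewrite zE mulmxK// wmx_unit.
  by rewrite mxE; apply: eq_bigr => i _; rewrite /eta inord_val.
pose c : 'cV[R]_d := \col_i (e ^+ i * z 0 (inord i)).
have gc : vert_mx e x *m c = 0.
  apply/colP => l; rewrite !mxE -[RHS](yv l).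
  under [RHS]eq_bigr do rewrite yE mulr_suml.
  rewrite [RHS]exchange_big /= [RHS]big_ord_recr /=.
  rewrite [X in _ = _ + X]big1 ?addr0; last first.
    move=> m _; rewrite (_ : ord_max = inord d) ?zd ?mul0r//.
    by apply: val_inj; rewrite /= inordK.
  apply: eq_bigr => i _; rewrite !mxE.
  transitivity (z 0 (inord i) * vert i l e x); first by field.
  rewrite mulr_sumr; apply: eq_bigr => m _.
  rewrite mulrA; congr (z 0 _ * _ * _); apply: val_inj => /=.
  by rewrite inordK// ltnS ltnW.
have c0 : c = 0 by rewrite -(mulKmx uG c) gc mulmx0.
have z0 : z = 0.
  apply/rowP => i; rewrite [RHS]mxE.
  have [id|id] := ltnP i d; last first.
    rewrite -[RHS]zd; congr (z 0 _); apply: val_inj; rewrite /= inordK//.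
    by apply/eqP; rewrite eqn_leq id -ltnS ltn_ord.
  have /colP/(_ (Ordinal id)) := c0; rewrite !mxE /= => /eqP.
  rewrite mulf_eq0 (negbTE (ei i)) /= => /eqP.
  by rewrite inord_val.
by rewrite -(mulmxK (wmx_unit x) y) -zE z0 mul0mx.
Qed.

(** A covector z annihilating both the vertices and v exists because the
    determinant vanishes; by [vert_kernel] it is a multiple of the covector H. *)
Lemma covec_annihilates : near0 (fun e x => forall v : 'I_d.+1 -> R,
  \det (\matrix_(i < d.+1, l < d.+1)
     if (l < d)%N then g i (x + k l * e) else v i) = 0 ->
  \sum_m covec m e x * v m = 0).
Proof.
apply: near0_2 covec_vert vert_kernel => e x hv hk v /eqP/det0P[y y0 yA].
have yv (l : 'I_d) : \sum_m y 0 m * g m (x + k l * e) = 0.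
  have /rowP/(_ (inord l)) := yA; rewrite !mxE => {2}<-.
  apply: eq_bigr => m _; rewrite mxE inordK ?ltn_ord//.
  by rewrite ltnS ltnW.
have yd : \sum_m y 0 m * v m = 0.
  have /rowP/(_ ord_max) := yA; rewrite !mxE => {2}<-.
  by apply: eq_bigr => m _; rewrite mxE ltnn.
pose t := \sum_m y 0 m * (g m)^`(d) x.
have E : y - t *: \row_m covec m e x = 0.
  apply: hk => [l|].
    under eq_bigr do rewrite !mxE mulrBl -mulrA.
    by rewrite sumrB yv -mulr_sumr hv mulr0 subr0.
  under eq_bigr do rewrite !mxE mulrBl -mulrA.
  by rewrite sumrB -mulr_sumr covec_top mulr1 subrr.
have yE : y = t *: \row_m covec m e x by apply/eqP; rewrite -subr_eq0 E.
have t0 : t != 0 by apply: contra y0 => /eqP t0; rewrite yE t0 scale0r.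
move: yd; rewrite yE; under eq_bigr do rewrite !mxE -mulrA.
by rewrite -mulr_sumr => /eqP; rewrite mulf_eq0 (negbTE t0) => /eqP.
Qed.

(** * The second order approximation of the envelope *)

Definition ansatz (m : 'I_d.+1) (e x : R) : R :=
  g m x + - kappa * e ^+ 2 * Qop d u (g m) x.

Lemma smooth_Qg m : smooth (Qop d u (g m)).
Proof. exact: (smooth_Qop (@smooth_u n.+1 (ltnSn _)) (@smooth_g m)). Qed.

Lemma tame_Qg m j : tame (fun _ => (Qop d u (g m))^`(j)).
Proof. exact: (tame_derive1n j (tame_smooth (@smooth_Qg m))). Qed.

Lemma derive1n_ansatz m e j x : (ansatz m e)^`(j) x =
  (g m)^`(j) x + - kappa * e ^+ 2 * (Qop d u (g m))^`(j) x.
Proof.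
rewrite /ansatz (derive1n_add j x (@smooth_g m) (smoothZ (@smooth_Qg m))).
by rewrite (derive1n_scale j _ x (@smooth_Qg m)).
Qed.

Lemma small_ansatz m j : small 2 (fun e x => (ansatz m e)^`(j) x - (g m)^`(j) x).
Proof.
apply: small_eq (smallMr (smallMl (tame_cst (- kappa)) (@small_pow R 2)) (tame_Qg m j)) => e x.
by rewrite derive1n_ansatz [RHS]addrC addrA addNr add0r.
Qed.

Lemma tame_ansatz m : tame (ansatz m).
Proof. exact: tame_small_sub (small_ansatz m 0) (tame_g m 0). Qed.

(** Up to lower derivatives of g, which eta_d kills, (Q g)^(j) is g^(j+2). *)
Lemma eta_Qg j x : (j < d)%N ->
  \sum_m eta d m x * (Qop d u (g m))^`(j) x = (n == j)%:R.
Proof.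
move=> jd.
have Q m := @derive1n_Qop R d u (g m) j x (@smooth_u n.+1 (ltnSn _)) (@smooth_g m).
under eq_bigr do rewrite Q mulrDr.
rewrite big_split /=.
have -> : \sum_m eta d m x * (2 / d.+1%:R *
    \sum_(i < j.+1) 'C(j, i)%:R * (u n.+1)^`(j - i) x * (g m)^`(i) x) = 0.
  under eq_bigr do rewrite mulrA mulr_sumr.
  rewrite exchange_big big1 //= => i _.
  transitivity (2 / d.+1%:R * 'C(j, i)%:R * (u n.+1)^`(j - i) x * eta_g d i x).
    rewrite /eta_g mulr_sumr; apply: eq_bigr => m _.
    by move: (derive1n _ _ _) (derive1n _ _ _) => p q; ring.
  have id : (i < d)%N by exact: leq_trans (ltn_ord i) jd.
  by rewrite eta_g_low ?(ltnW id)// (gtn_eqF id) mulr0.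
rewrite addr0 -[LHS]/(eta_g d j.+2 x).
have [jn|jn] := leqP j n; first by rewrite eta_g_low//.
have -> : j = n.+1 by lia.
by rewrite eta_g_top// ltnn mul0r oppr0 ltn_eqF.
Qed.

(** The two terms of order e^2, kappa eta_(d-2).g^(j) and - kappa eta_d.(Q g)^(j),
    cancel: both pairings are 1 for j = d - 2 and 0 for the other j < d. *)
Lemma small_covec_ansatz j : (j < d)%N -> small 3 (pairing covec ansatz 0 j).
Proof.
move=> jd.
have s1 := small_sum (index_enum 'I_d.+1)
  (fun m => smallMr (small_covec m) (tame_derive1n j (tame_ansatz m))).
have t2 : tame (fun _ x => - (kappa * kappa) * \sum_m eta n m x * (Qop d u (g m))^`(j) x).
  apply: (tameM (tame_cst _)); apply: tame_sum => m.
  exact: (tameM (tame_eta n m) (tame_Qg m j)).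
have s2 := smallW (isT : 3 <= 4)%N (smallMr (@small_pow R 4) t2).
apply: small_eq (smallD s1 s2) => e x; rewrite /pairing.
under eq_bigr do rewrite mulrBl.
rewrite sumrB -addrA -[RHS]addr0; congr (_ + _).
transitivity (- (eta_g d j x + e ^+ 2 * kappa * (eta_g n j x -
    \sum_m eta d m x * (Qop d u (g m))^`(j) x))).
  rewrite /eta_g -sumrB [_ * kappa * _]mulr_sumr -big_split /= -sumrN mulrA mulr_sumr.
  rewrite -sumrN -big_split /=; apply: eq_bigr => m _; rewrite derive1n_ansatz.
  by move: (derive1n j _ _) (derive1n j _ _) => p q; ring.
rewrite eta_Qg// eta_g_low ?(ltnW jd)// eta_g_low 1?ltnW// gtn_eqF//.
by rewrite subrr mulr0 addr0 oppr0.
Qed.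

Lemma small_covec_ansatz_top : small 1 (fun e x => pairing covec ansatz 0 d e x - 1).
Proof.
have s1 := small_sum (index_enum 'I_d.+1)
  (fun m => smallMl (tame_covec m) (small_ansatz m d)).
apply: small_eq (smallW (isT : 1 <= 2)%N s1) => e x.
rewrite -(covec_top e x) /pairing -sumrB; apply: eq_bigr => m _.
by rewrite mulrBr.
Qed.

Lemma near_wmx (F : 'I_d.+1 -> 'I_d.+1 -> R -> R -> R) :
  (forall i j, small 1 (fun e x => F i j e x - (g i)^`(j) x)) ->
  near0 (fun e x => (\matrix_(i, j) F i j e x) \in unitmx) /\
  tame_mx (fun e x => invmx (\matrix_(i, j) F i j e x)).
Proof.
move=> sF.
have tF : tame_mx (fun e x => \matrix_(i, j) F i j e x).
  move=> i j; apply: tame_ext (tame_small_sub (sF i j) (tame_g i j)).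
  by apply: near0_all => e x; rewrite mxE.
have tW : @tame_mx R d.+1 d.+1 (fun _ x => wmx x).
  by move=> p q; apply: tame_ext (tame_g p q); apply: near0_all => e x; rewrite mxE.
apply: (tame_invmx (oner_neq0 R) tF).
have sFW : small_mx 1 (fun e x => \matrix_(i, j) F i j e x) (fun _ x => wmx x).
  by move=> i j; apply: small_eq (sF i j) => e x; rewrite !mxE.
by apply: small_eq (small_sub_det tF tW sFW) => e x; rewrite det_wmx.
Qed.

(** Writing the envelope as sum_m b_m X^(m) with X the approximation, the equations
    H^(i).E = 0, i < d, read
    [pairing_mx *m (b_d, ..., b_1) = - b_0 pairing_col].  The unknowns are listed in
    decreasing order so that the matrix is lower triangular up to O(e). *)
Definition pairing_mx (e x : R) : 'M[R]_d :=
  \matrix_(i, j) pairing covec ansatz i (d - j) e x.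
Definition pairing_col (e x : R) : 'cV[R]_d := \col_i pairing covec ansatz i 0 e x.
Definition env_coef e x : 'cV[R]_d := - (invmx (pairing_mx e x) *m pairing_col e x).

Lemma pairing_mx_inv : near0 (fun e x => pairing_mx e x \in unitmx) /\
  tame_mx (fun e x => invmx (pairing_mx e x)).
Proof.
have tP i j := tame_pairing i j tame_covec tame_ansatz.
have tK : tame_mx pairing_mx.
  by move=> i j; apply: tame_ext (tP i (d - j)%N); apply: near0_all => e x; rewrite mxE.
(* the triangular matrix that pairing_mx is congruent to modulo e *)
pose T (e x : R) : 'M[R]_d := \matrix_(i, j) (if (i < j)%N then 0 else
  if i == j then (-1) ^+ i else pairing covec ansatz i (d - j) e x).
have tT : tame_mx T.
  move=> i j; case: (ltnP i j) => ij.
    by apply: tame_ext (tame_cst 0); apply: near0_all => e x; rewrite mxE ij.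
  case: (eqVneq i j) => ije.
    apply: tame_ext (tame_cst ((-1) ^+ i)); apply: near0_all => e x.
    by rewrite mxE ltnNge ij /= ije eqxx.
  apply: tame_ext (tP i (d - j)%N); apply: near0_all => e x.
  by rewrite mxE ltnNge ij /= (negbTE ije).
have KT : small_mx 1 pairing_mx T.
  move=> i j; case: (ltnP i j) => ij.
    have h := small_pairing tame_covec tame_ansatz small_covec_ansatz (_ : i + (d - j) < d)%N.
    have lt : (i + (d - j) < d)%N by have := ltn_ord j; lia.
    apply: small_eq (smallW (isT : 1 <= 3)%N (h lt)) => e x.
    by rewrite !mxE ij subr0.
  case: (eqVneq i j) => ije.
    have h := small_pairing_diag tame_covec tame_ansatz
      (fun j jd => smallW (isT : 1 <= 3)%N (small_covec_ansatz jd))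
      small_covec_ansatz_top (ltnW (ltn_ord i)).
    apply: small_eq h => e x.
    by rewrite !mxE ltnNge ij /= -ije eqxx.
  apply: small_eq (@small_zero R 1) => e x.
  by rewrite !mxE ltnNge ij /= (negbTE ije) subrr.
have a0 : \prod_(i < d) (-1) ^+ i != 0 :> R.
  by apply/prodf_neq0 => i _; rewrite signr_eq0.
apply: (tame_invmx a0 tK).
apply: small_eq (small_sub_det tK tT KT) => e x; congr (_ - _).
rewrite det_trig; last by apply/is_trig_mxP => i j ij; rewrite mxE ij.
by apply: eq_bigr => i _; rewrite mxE ltnn eqxx.
Qed.

(** The right hand side [pairing_col] is O(e^3). *)
Lemma small_env_coef j : small 3 (fun e x => env_coef e x j 0).
Proof.
have h (i : 'I_d) : small 3 (fun e x => pairing_col e x i 0).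
  have lt : (i + 0 < d)%N by rewrite addn0.
  apply: small_eq (small_pairing tame_covec tame_ansatz small_covec_ansatz lt) => e x.
  by rewrite mxE.
apply: small_eq (smallN (small_mulmx pairing_mx_inv.2 h j)) => e x.
by rewrite [RHS]mxE.
Qed.

(** The multiple of the envelope whose coordinate b_0 is 1. *)
Definition env m e x : R :=
  ansatz m e x + \sum_(j < d) env_coef e x j 0 * (ansatz m e)^`(d - j) x.

Lemma small_env_ansatz m : small 3 (fun e x => env m e x - ansatz m e x).
Proof.
apply: small_eq (small_sum (index_enum 'I_d) (fun j =>
  smallMr (small_env_coef j) (tame_derive1n (d - j) (tame_ansatz m)))) => e x.
by rewrite /env [RHS]addrC addrA addNr add0r.
Qed.

Lemma tame_env m : tame (env m).
Proof. exact: tame_small_sub (small_env_ansatz m) (tame_ansatz m). Qed.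

Lemma small_derive1n_sub s (F K : R -> R -> R) j : tame F -> tame K ->
  small s (fun e x => F e x - K e x) ->
  small s (fun e x => (F e)^`(j) x - (K e)^`(j) x).
Proof.
move=> tF tK sFK; elim: j => [|j IH] //.
apply: small_ext (small_derive1 IH).
apply: near0_2 (tame_derivable_dern j tF) (tame_derivable_dern j tK) => e x dF dK.
by rewrite derive1E (deriveB dF dK) -!derive1E !derive1nS.
Qed.

Lemma small_env m j : small 1 (fun e x => (env m e)^`(j) x - (g m)^`(j) x).
Proof.
have h1 := smallW (isT : 1 <= 3)%N
  (small_derive1n_sub j (tame_env m) (tame_ansatz m) (small_env_ansatz m)).
have h2 := smallW (isT : 1 <= 2)%N (small_ansatz m j).
by apply: small_eq (smallD h1 h2) => e x; rewrite addrA subrK.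
Qed.

(** * Comparison with the envelope *)

Section Envelope.
Variable y : 'I_d.+1 -> R -> R -> R.
Hypothesis smooth_y : \forall e \near 0^'+, forall m, smooth (y m e).
Hypothesis det_y : \forall e \near 0^'+, forall (x : R) (j : nat), (j < d)%N ->
  \det (\matrix_(i < d.+1, l < d.+1)
     if (l < d)%N then g i (x + k l * e) else (y i e)^`(j) x) = 0.
Hypothesis y_neq0 : \forall e \near 0^'+, forall x, exists m, y m e x != 0.

Lemma derivable_y m j : near0 (fun e x => derivable (y m e)^`(j) x 1).
Proof.
have h : \forall e \near 0^'+, forall x, derivable (y m e)^`(j) x 1.
  by apply: filterS smooth_y => e sy x; exact: (sy m j x).
by apply: near0W (near0_param h) => e x; apply.
Qed.

Lemma covec_y i : (i < d)%N -> near0 (fun e x => pairing covec y i 0 e x = 0).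
Proof.
move=> id.
have h0 j : (j < d)%N -> near0 (fun e x => pairing covec y 0 j e x = 0).
  move=> jd; apply: near0_2 covec_annihilates (near0_param det_y) => e x hx dx.
  by apply: (hx (fun m => (y m e)^`(j) x)); exact: dx.
apply: (pairing_zero _ derivable_y h0); last by rewrite addn0.
by move=> m j; exact: tame_derivable_dern (tame_covec m).
Qed.

Definition ansatz_jet (e x : R) : 'M[R]_d.+1 := \matrix_(i, j) (ansatz i e)^`(j) x.

Lemma ansatz_jet_inv : near0 (fun e x => ansatz_jet e x \in unitmx) /\
  tame_mx (fun e x => invmx (ansatz_jet e x)).
Proof.
apply: (near_wmx (F := fun i j e x => (ansatz i e)^`(j) x)) => i j.
exact: smallW (isT : 1 <= 2)%N (small_ansatz i j).
Qed.

Definition ansatz_coord e x : 'cV[R]_d.+1 := invmx (ansatz_jet e x) *m \col_m y m e x.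
(** The coordinate b_0 of the envelope. *)
Definition multiplier e x : R := ansatz_coord e x ord0 0.

(** The d coordinates b_1, ..., b_d are determined by b_0, since the matrix of the
    equations H^(i).E = 0 in these unknowns is invertible. *)
Lemma y_env : near0 (fun e x => forall m, y m e x = multiplier e x * env m e x).
Proof.
have [uA _] := ansatz_jet_inv; have [uK _] := pairing_mx_inv.
have hy := near0_forall (fun i : 'I_d => covec_y (ltn_ord i)).
apply: near0_3 uA uK hy => e x uA uK hy.
have yE m : y m e x = \sum_(j < d.+1) (ansatz m e)^`(j) x * ansatz_coord e x j 0.
  have : (ansatz_jet e x *m ansatz_coord e x) m 0 = y m e x by rewrite mulKVmx// mxE.
  by rewrite mxE => <-; apply: eq_bigr => j _; rewrite mxE.
have revE (F : nat -> R) : \sum_(j < d.+1) F j = F 0%N + \sum_(j < d) F (d - j)%N.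
  rewrite big_ord_recl; congr (_ + _); rewrite (reindex_inj rev_ord_inj) /=.
  by apply: eq_bigr => j _; congr F; rewrite /bump /=; have := ltn_ord j; lia.
pose z : 'cV[R]_d := \col_j ansatz_coord e x (inord (d - j)) 0.
have ks i : pairing covec ansatz i 0 e x * multiplier e x +
    \sum_(j < d) pairing covec ansatz i (d - j) e x * z j 0 = pairing covec y i 0 e x.
  rewrite /pairing.
  have -> : \sum_m (covec m e)^`(i) x * (y m e)^`(0) x =
      \sum_(j < d.+1) pairing covec ansatz i j e x * ansatz_coord e x (inord j) 0.
    under eq_bigr do rewrite derive1n0 yE mulr_sumr.
    rewrite exchange_big /=; apply: eq_bigr => j _; rewrite inord_val /pairing mulr_suml.
    by apply: eq_bigr => m _; rewrite mulrA.
  rewrite (revE (fun j => pairing covec ansatz i j e x * ansatz_coord e x (inord j) 0)).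
  congr (_ * _ + _); last by apply: eq_bigr => j _; rewrite mxE.
  by rewrite /multiplier; congr (ansatz_coord e x _ 0); apply: val_inj; rewrite /= inordK.
have zE : z = multiplier e x *: env_coef e x.
  have : pairing_mx e x *m z = - (multiplier e x *: pairing_col e x).
    apply/colP => i; rewrite !mxE.
    have := ks i; rewrite hy => /eqP; rewrite addrC addr_eq0 => /eqP h.
    by rewrite -[multiplier _ _ * _]mulrC -h; apply: eq_bigr => j _; rewrite mxE.
  move=> /(congr1 (mulmx (invmx (pairing_mx e x)))); rewrite mulKmx// => ->.
  by rewrite mulmxN -scalemxAr /env_coef scalerN.
move=> m; pose F j := (ansatz m e)^`(j) x * ansatz_coord e x (inord j) 0.
have -> : y m e x = \sum_(j < d.+1) F j.
  by rewrite yE; apply: eq_bigr => j _; rewrite /F inord_val.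
rewrite revE /F.
rewrite /env mulrDr; congr (_ + _).
  rewrite derive1n0 mulrC; congr (_ * _).
  by rewrite /multiplier; congr (ansatz_coord e x _ 0); apply: val_inj; rewrite /= inordK.
rewrite mulr_sumr; apply: eq_bigr => j _.
have /colP/(_ j) := zE; rewrite [LHS]mxE [RHS]mxE => ->.
by rewrite mulrC mulrA.
Qed.

Lemma multiplier_neq0 : near0 (fun e x => multiplier e x != 0).
Proof.
apply: near0_2 y_env (near0_param y_neq0) => e x yE /(_ x)[m].
by apply: contraNneq => m0; rewrite yE m0 mul0r.
Qed.

(** The envelope is only known to be smooth for each e, so that the bound depends on
    e; this is all that is needed for Leibniz' formula. *)
Lemma ck_multiplier N r : \forall e \near 0^'+, exists C, ck_bound N r C (multiplier e).
Proof.
have [_ tA] := ansatz_jet_inv.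
pose F m e x := invmx (ansatz_jet e x) ord0 m * y m e x.
have hF m : \forall e \near 0^'+, exists C, ck_bound N r C (F m e).
  have [C hC] := tA ord0 m N r.
  apply: filterS2 hC smooth_y => e hC sy.
  have [D hD] := smooth_ck_bound N r (sy m).
  by exists (2 ^+ N * (C * D)); exact: ck_boundM.
have hF' : \forall e \near 0^'+, forall m, exists C, ck_bound N r C (F m e).
  by apply: filter_forall => m; exact: hF.
apply: filterS hF' => e he.
have ck_sum (s : seq 'I_d.+1) : exists C, ck_bound N r C (fun x => \sum_(m <- s) F m e x).
  elim: s => [|m s [C hC]].
    exists `|0 : R|; apply: ck_bound_ext (ck_bound_cst N r 0) => x _; by rewrite big_nil.
  have [D hD] := he m; exists (D + C).
  by apply: ck_bound_ext (ck_boundD hD hC) => x _; rewrite big_cons.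
have [C hC] := ck_sum (index_enum 'I_d.+1); exists C.
apply: ck_bound_ext hC => x _; rewrite /multiplier /ansatz_coord mxE.
by apply: eq_bigr => m _; rewrite mxE.
Qed.

Lemma derivable_multiplier : near0 (fun e x => derivable (multiplier e) x 1).
Proof.
move=> r; apply: filterS (ck_multiplier 1 r) => e [C hC].
exact: ck_bound_derivable hC.
Qed.

Variable w : nat -> R -> R.
Hypothesis smooth_w : forall j, (j < d)%N -> smooth (w j).
Hypothesis w_commutator : forall f : R -> R, smooth f -> forall x,
  \sum_(j < d) w j x * f^`(j) x =
  - kappa * (Qop d u (lax d u f) x - lax d u (Qop d u f) x).

(** L + e^2 W applied to a jet F, which need not be the sequence of derivatives of
    one function: see [twisted_jet]. *)
Definition lax2 (F : nat -> R -> R -> R) (e x : R) : R :=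
  F d.+1 e x + \sum_(j < d) (u j x + e ^+ 2 * w j x) * F j e x.

Lemma tame_coef (j : 'I_d) : tame (fun e x => u j x + e ^+ 2 * w j x).
Proof.
apply: (tameD (tame_smooth (smooth_u (ltn_ord j)))).
exact: (tameM (@tame_pow R 2) (tame_smooth (smooth_w (ltn_ord j)))).
Qed.

Lemma small_lax2 s (F K : nat -> R -> R -> R) :
  (forall j, small s (fun e x => F j e x - K j e x)) ->
  small s (fun e x => lax2 F e x - lax2 K e x).
Proof.
move=> h; have h2 := small_sum (index_enum 'I_d)
  (fun j : 'I_d => smallMl (tame_coef j) (h j)).
apply: small_eq (smallD (h d.+1) h2) => e x; rewrite /lax2 opprD addrACA; congr (_ + _).
by rewrite -sumrB; apply: eq_bigr => j _; rewrite mulrBr.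
Qed.

(** (L + e^2 W) (g + c e^2 Q g) = e^2 (c L Q g + W g) + c e^4 W Q g, since L g = 0.
    As moreover W g = c (Q L g - L Q g) = - c L Q g, only the last term is left. *)
Lemma small_lax2_ansatz m : small 3 (lax2 (fun j e => (ansatz m e)^`(j))).
Proof.
have t : tame (fun _ x => - kappa * \sum_(j < d) w j x * (Qop d u (g m))^`(j) x).
  apply: (tameM (tame_cst _)); apply: tame_sum => j.
  exact: (tameM (tame_smooth (smooth_w (ltn_ord j))) (tame_Qg m j)).
apply: small_eq (smallW (isT : 3 <= 4)%N (smallMr (@small_pow R 4) t)) => e x.
have L0 : lax d u (g m) = fun=> 0 by apply/funext => z; exact: lax_g.
have wg := w_commutator (@smooth_g m) x.
rewrite L0 /Qop derive1n_cst mulr0 addr0 sub0r -/(Qop d u (g m)) in wg.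
have lg := lax_g m x; rewrite laxE in lg.
rewrite laxE in wg; rewrite /lax2.
have -> : \sum_(j < d) (u j x + e ^+ 2 * w j x) * (ansatz m e)^`(j) x =
   \sum_(j < d) u j x * (g m)^`(j) x +
   - kappa * e ^+ 2 * (\sum_(j < d) u j x * (Qop d u (g m))^`(j) x)
   + e ^+ 2 * (\sum_(j < d) w j x * (g m)^`(j) x)
   + - kappa * e ^+ 4 * (\sum_(j < d) w j x * (Qop d u (g m))^`(j) x).
  rewrite !mulr_sumr -!big_split /=; apply: eq_bigr => j _; rewrite derive1n_ansatz.
  by move: (derive1n j _ _) (derive1n j _ _) => p q; ring.
rewrite derive1n_ansatz wg.
have -> : (g m)^`(d.+1) x = - \sum_(j < d) u j x * (g m)^`(j) x.
  by apply/eqP; rewrite -addr_eq0 lg.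
by move: (\sum_(j < d) _) (\sum_(j < d) _) (\sum_(j < d) _) (derive1n _ _ _) => p q r z; ring.
Qed.

Lemma small_lax2_env m : small 3 (lax2 (fun j e => (env m e)^`(j))).
Proof.
have h j := small_derive1n_sub j (tame_env m) (tame_ansatz m) (small_env_ansatz m).
by apply: small_eq (smallD (small_lax2 h) (small_lax2_ansatz m)) => e x; rewrite subrK.
Qed.

Definition env_jet (e x : R) : 'M[R]_d.+1 := \matrix_(i, j) (env i e)^`(j) x.

Lemma env_jet_inv : near0 (fun e x => env_jet e x \in unitmx) /\
  tame_mx (fun e x => invmx (env_jet e x)).
Proof. exact: (near_wmx small_env). Qed.

(** The coordinates of the O(e^3) vector (L + e^2 W) X in the basis of the X^(j). *)
Definition defect (e x : R) : 'cV[R]_d.+1 :=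
  invmx (env_jet e x) *m \col_m lax2 (fun j e => (env m e)^`(j)) e x.

Lemma small_defect j : small 3 (fun e x => defect e x j 0).
Proof.
apply: (small_mulmx env_jet_inv.2) => i.
by apply: small_eq (small_lax2_env i) => e x; rewrite mxE.
Qed.

Definition rho (e x : R) : R := - (defect e x ord_max 0 / d.+1%:R).

Lemma small_rho : small 3 rho.
Proof. exact: (smallN (smallMr (small_defect ord_max) (tame_cst _))). Qed.

Variable ue : R -> nat -> R -> R.
Hypothesis lax_y : \forall e \near 0^'+, forall x m, lax d (ue e) (y m e) x = 0.

(** The envelope b X and X both satisfy an equation of order d + 1 in which the term
    of order d is absent, up to the last coordinate s_d of the defect for X.  The
    coefficient of X^(d) in the equation of b X is (d+1) b' + b s_d, so it is 0. *)
Lemma derive1_multiplier :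
  near0 (fun e x => (multiplier e)^`() x = multiplier e x * rho e x).
Proof.
have [uN _] := env_jet_inv.
have key : near0 (fun e x => forall m, forall j, (j <= d.+1)%N -> (y m e)^`(j) x =
    \sum_(i < d.+2) 'C(j, i)%:R * (multiplier e)^`(j - i) x * (env m e)^`(i) x).
  move=> r.
  have he : \forall e \near 0^'+, forall m, exists C, ck_bound d.+1 r C (env m e).
    apply: filter_forall => m; have [C hC] := tame_env m d.+1 r.
    by apply: filterS hC => e he; exists C.
  apply: filterS3 (ck_multiplier d.+1 r) he (y_env r) => e [C hC] he ye x xr m j jd.
  have [D hD] := he m.
  rewrite (derive1n_ext (fun z zr => ye z zr m) j xr).
  exact: (leibniz_ball_wide hC hD jd _ xr).
apply: near0_3 uN key (near0_param lax_y) => e x uN key lxy.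
pose s i := defect e x (inord i) 0.
pose q := top_relation d (fun j => (multiplier e)^`(j) x) (ue e ^~ x)
  (fun j => u j x + e ^+ 2 * w j x) s.
have Nq : env_jet e x *m (\col_i q i) = 0.
  apply/colP => m; rewrite [LHS]mxE [RHS]mxE.
  transitivity (\sum_(i < d.+1) (env m e)^`(i) x * q i).
    by apply: eq_bigr => i _; rewrite !mxE.
  apply: (@top_relationP R d _ _ _ s (fun j => (env m e)^`(j) x)
    (fun j => (y m e)^`(j) x)) => [j jd||].
  - exact: key.
  - by have := lxy x m; rewrite laxE.
  - have : (env_jet e x *m defect e x) m 0 = lax2 (fun j e => (env m e)^`(j)) e x.
      by rewrite mulKVmx// mxE.
    rewrite /lax2 => <-; rewrite [RHS]mxE; apply: eq_bigr => i _.
    by rewrite /s inord_val [env_jet _ _ _ _]mxE.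
have q0 : \col_i q i = 0 :> 'cV[R]_d.+1 by rewrite -(mulKmx uN (\col_i q i)) Nq mulmx0.
have /colP/(_ ord_max) := q0; rewrite !mxE /q /top_relation /= ltnn => h.
have sE : s d = defect e x ord_max 0.
  by rewrite /s; congr (defect e x _ 0); apply: val_inj; rewrite /= inordK.
rewrite /rho -sE; move: h; rewrite ?derive1n0.
move: (s d) (multiplier e x) ((multiplier e)^`() x) => a b c h.
have d0 : d.+1%:R != 0 :> R by rewrite pnatr_eq0.
apply: (mulfI d0); rewrite mulrCA mulrN [X in - X]mulrCA divff// mulr1 mulrN.
by apply/eqP; rewrite -addr_eq0; apply/eqP.
Qed.

(** The operators b^-1 o d^j o b = (d + rho)^j applied to X, where rho = b'/b. *)
Fixpoint twisted_jet (j : nat) (m : 'I_d.+1) (e : R) : R -> R :=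
  if j is i.+1 then fun x => (twisted_jet i m e)^`() x + rho e x * twisted_jet i m e x
  else env m e.

Lemma small_twisted_jet j m : small 3 (fun e x => twisted_jet j m e x - (env m e)^`(j) x).
Proof.
elim: j => [|j IH].
  by apply: small_eq (@small_zero R 3) => e x; rewrite subrr.
have tE := tame_derive1n j (tame_env m).
have tJ : tame (twisted_jet j m) := tame_small_sub IH tE.
have s1 := small_derive1n_sub 1 tJ tE IH.
apply: small_eq (smallD s1 (smallMr small_rho tJ)) => e x.
by rewrite /= addrAC.
Qed.

Lemma tame_twisted_jet j m : tame (twisted_jet j m).
Proof. exact: tame_small_sub (small_twisted_jet j m) (tame_derive1n j (tame_env m)). Qed.

Lemma derive1n_y j : near0 (fun e x => forall m,
  (y m e)^`(j) x = multiplier e x * twisted_jet j m e x).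
Proof.
elim: j => [|j IH]; first exact: y_env.
have IH' : near0 (fun e x => forall m,
    (y m e)^`(j.+1) x = (fun x => multiplier e x * twisted_jet j m e x)^`() x).
  move=> r; apply: filterS (IH r) => e he x xr m.
  by rewrite derive1nS; apply: derive1_ext xr => z zr; exact: he.
have dJ := near0_forall (fun m => tame_derivable (tame_twisted_jet j m)).
have h := near0_3 (fun e x a b c => conj a (conj b c)) IH' dJ derivable_multiplier.
apply: near0_2 h derive1_multiplier => e x [yE [dj dm]] rE m.
rewrite yE derive1M// rE /= mulrDr addrC; congr (_ + _).
by rewrite mulrA.
Qed.

(** The differences z_j of the coefficients satisfy, after division by b,
    sum_(j < d) z_j (d + rho)^j X = - (d + rho)^(d+1) X
      - sum_(j < d) (u_j + e^2 w_j) (d + rho)^j X,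
    whose right hand side is O(e^3).  The matrix of the system is completed by the
    column j = d to one that is close to the Wronskian matrix, and z by z_d = 0. *)
Lemma small_ue (j : 'I_d) : small 3 (fun e x => ue e j x - (u j x + e ^+ 2 * w j x)).
Proof.
have twN m i : small 1 (fun e x => twisted_jet i m e x - (g m)^`(i) x).
  have h := smallW (isT : 1 <= 3)%N (small_twisted_jet i m).
  by apply: small_eq (smallD h (small_env m i)) => e x; rewrite addrA subrK.
have [uZ tZ] := near_wmx (F := fun m (i : 'I_d.+1) => twisted_jet i m) (fun m i => twN m i).
have sl m : small 3 (lax2 (fun j => twisted_jet j m)).
  have h := small_lax2 (F := fun j => twisted_jet j m) (fun j => small_twisted_jet j m).
  by apply: small_eq (smallD h (small_lax2_env m)) => e x; rewrite subrK.
pose z e x : 'cV[R]_d.+1 := \col_i (if (i < d)%N then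
  ue e i x - (u i x + e ^+ 2 * w i x) else 0).
pose b e x : 'cV[R]_d.+1 := \col_m - lax2 (fun j => twisted_jet j m) e x.
have sb m : small 3 (fun e x => b e x m 0).
  by apply: small_eq (smallN (sl m)) => e x; rewrite mxE.
have yj := near0_forall (fun i : 'I_d.+2 => derive1n_y i).
have h := near0_3 (fun e x a b c => conj a (conj b c)) yj multiplier_neq0 (near0_param lax_y).
have jd : (j < d.+1)%N by rewrite ltnW// ltnS ltn_ord.
apply: small_ext (small_mulmx tZ sb (Ordinal jd)).
apply: near0_2 uZ h => e x uZ [yE [m0 lxy]].
suff zE : (\matrix_(m, i) twisted_jet i m e x) *m z e x = b e x.
  by rewrite -zE mulKmx// mxE /= ltn_ord.
apply/colP => m; rewrite [LHS]mxE [RHS]mxE big_ord_recr /= !mxE /= ltnn mulr0 addr0.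
apply: (mulfI m0); rewrite mulrN /lax2 mulrDr opprD.
have := lxy x m; rewrite laxE (yE ord_max) => /eqP; rewrite addr_eq0 => /eqP ->.
rewrite opprK !mulr_sumr -sumrN -big_split /=; apply: eq_bigr => i _.
have id : (i < d.+2)%N by have := ltn_ord i; lia.
by rewrite !mxE /= ltn_ord (yE (Ordinal id)) /=; ring.
Qed.

End Envelope.
End Curve.

(** * The continuous limit *)

Section Components.
Variable R : realType.

Lemma smooth_component p (G : R -> 'cV[R]_p.+1) : smooth G -> forall m j,
  (fun x => G x m 0)^`(j) = (fun x => G^`(j) x m 0).
Proof.
move=> sG m; elim=> [|j IH] //; rewrite derive1nS IH; apply/funext => x.
by rewrite derive1nS !derive1E derive_mx ?mxE//; exact: sG.
Qed.

Lemma smooth_componentP p (G : R -> 'cV[R]_p.+1) : smooth G ->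
  forall m, smooth (fun x => G x m 0).
Proof.
move=> sG m j x; rewrite smooth_component//.
exact: ((derivable_mxP _ _ _).1 (sG j x) m 0).
Qed.

Lemma lax_component p d (u : nat -> R -> R) (G : R -> 'cV[R]_p.+1) m x : smooth G ->
  lax d u (fun z => G z m 0) x = lax d u G x m 0.
Proof.
move=> sG; rewrite laxE /lax mxE summxE smooth_component//; congr (_ + _).
by apply: eq_bigr => j _; rewrite mxE smooth_component.
Qed.

Lemma wronskian_component d (G : R -> 'cV[R]_d.+1) x : smooth G ->
  wronskian G x = \det (\matrix_(i < d.+1, j < d.+1) (fun z => G z i 0)^`(j) x).
Proof.
move=> sG; congr (\det _); apply/matrixP => i j.
by rewrite !mxE smooth_component.
Qed.

Lemma centered_shifts_incr d (I : d.-1.-tuple nat) (k : nat -> R) :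
  (forall l : 'I_d.-1, (0 < tnth I l)%N) -> centered_shifts I k ->
  forall i j, (i < j < d)%N -> k i < k j.
Proof.
move=> hI [hk _].
have step l : (l.+1 < d)%N -> k l < k l.+1.
  move=> ld; have ld' : (l < d.-1)%N by lia.
  by rewrite -subr_gt0 (hk (Ordinal ld')) ltr0n.
move=> i; elim=> [|j IH] /andP[ij jd] //.
move: ij; rewrite ltnS leq_eqVlt => /predU1P[->|ij]; first exact: step.
by apply: lt_trans (step j jd); apply: IH; rewrite ij ltnW.
Qed.

End Components.

Theorem theorem4p1 (R : realType) (d : nat) (I : d.-1.-tuple nat) (k : nat -> R)
    (hd : (2 <= d)%N) (hI : forall l : 'I_d.-1, (0 < tnth I l)%N)
    (hk : centered_shifts I k) :
  exists2 c : R, c != 0 &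
  forall (G : R -> 'cV[R]_d.+1) (u : nat -> R -> R)
    (E : R -> R -> 'cV[R]_d.+1) (ue : R -> nat -> R -> R),
    curve_lift G -> curve_coefficients G u ->
    (\forall e \near 0^'+, envelope_lift k G e (E e)) ->
    (forall x : R, E e x @[e --> 0^'+] --> G x) ->
    (\forall e \near 0^'+, forall x : R, lax d (ue e) (E e) x = 0) ->
    exists2 w : nat -> R -> R,
      second_order_expansion d u ue w & kdv2_flow d c u w.
Proof.
case: d hd I hI hk => [|[|n]] // hd I hI hk.
have kinc := centered_shifts_incr hI hk; have ksum := hk.2.
have kappa0 := kappa_lt0 kinc ksum.
exists (- kappa n k); first by rewrite oppr_eq0 lt_eqF.
move=> G u E ue [sG wG _] [hu lG] hE _ lE.
have su j : (j < n.+2)%N -> smooth (u j) by move=> jd; exact: (hu j jd).1.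
pose g m x := G x m 0.
have sg m : smooth (g m) by exact: smooth_componentP.
have lg m x : lax n.+2 u (g m) x = 0 by rewrite lax_component// lG mxE.
have dg x : \det (wmx g x) = 1 by rewrite -(wG x) wronskian_component.
pose y m e x := E e x m 0.
have sE : \forall e \near 0^'+, smooth (E e).
  by apply: filterS hE => e [].
have sy : \forall e \near 0^'+, forall m, smooth (y m e).
  by apply: filterS sE => e sE m; exact: smooth_componentP.
have dy : \forall e \near 0^'+, forall (x : R) (j : nat), (j < n.+2)%N ->
  \det (\matrix_(i < n.+3, l < n.+3)
     if (l < n.+2)%N then g i (x + k l * e) else (y i e)^`(j) x) = 0.
  apply: filterS2 sE hE => e sE [_ _ dE] x j jd.
  rewrite -[RHS](dE x j jd); congr (\det _); apply/matrixP => i l.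
  by rewrite !mxE smooth_component.
have ny : \forall e \near 0^'+, forall x, exists m, y m e x != 0.
  apply: filterS hE => e [_ wE _] x; apply: contrapT => /forallNP nz.
  have := wE x; rewrite /wronskian (expand_det_col _ ord0) big1.
    by move/eqP; rewrite eq_sym oner_eq0.
  move=> i _; rewrite mxE derive1n0.
  by have /negP := nz i; rewrite negbK /y => /eqP ->; rewrite mul0r.
have ly : \forall e \near 0^'+, forall x m, lax n.+2 (ue e) (y m e) x = 0.
  by apply: filterS2 sE lE => e sE lE x m; rewrite lax_component// lE mxE.
have [r sr hr] := commutator_diffop hd su.
pose w j x := - kappa n k * r j x.
have sw j : smooth (w j) by exact: smoothZ.
have wc f : smooth f -> forall x, \sum_(j < n.+2) w j x * f^`(j) x =
    - kappa n k * (Qop n.+2 u (lax n.+2 u f) x - lax n.+2 u (Qop n.+2 u f) x).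
  move=> sf x; rewrite hr// mulr_sumr; apply: eq_bigr => j _.
  by rewrite /w mulrA.
exists w.
  move=> j jd a b; pose rr := `|a| + `|b| + 1.
  have sue := small_ue kinc ksum sg su lg dg sy dy ny (fun j _ => sw j) wc ly (Ordinal jd).
  have [C hC] := tame_bounded rr sue; exists C.
  apply: filterS2 hC (nbhs_right_gt 0) => e hC e0 x; rewrite inE /= in_itv /= => /andP[ax xb].
  have xr : `|x| < rr.
    rewrite /rr ltr_norml; have := ler_norm b; have := ler_norm (- a).
    rewrite normrN; have := normr_ge0 a; have := normr_ge0 b => *.
    by apply/andP; split; lra.
  have e3 : 0 < e ^+ 3 by rewrite exprn_gt0.
  have := hC x xr; rewrite normrM gtr0_norm ?invr_gt0// ler_pdivrMl//.
  by rewrite [e ^+ 3 * C]mulrC.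
have [S hS] := lax_root_exists su; exists S => // f sf x.
have sqE h : square_plus S h = Qop n.+2 u h.
  by apply/funext => z; rewrite (square_plusE _ _ hd hS).
by rewrite !sqE wc.
Qed.
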